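(* Consider the stochastic variational inequality problem SVI$(X,F)$, where $F$ is a continuous monotone map over $X$, with solution set $X^*\neq\emptyset$. Suppose that: (A1) for all $k\ge 0$, almost surely $\mathbb{E}[w_k\mid\mathcal F_k]=0$ and $\mathbb{E}[w_{k+1/2}\mid\mathcal F_{k+1/2}]=0$; (A2) there exists $\nu>0$ such that for all $k\ge 0$, almost surely $\mathbb{E}[\|w_k\|^2\mid\mathcal F_k]\le\nu^2$ and $\mathbb{E}[\|w_{k+1/2}\|^2\mid\mathcal F_{k+1/2}]\le\nu^2$; (A3) $\sum_{k=0}^\infty\gamma_k^2<\infty$; (A4) $\sum_{k=0}^\infty\gamma_k=\infty$; (A5) there exist $L,B>0$ such that $\|F(x)-F(y)\|\le L\|x-y\|$ and $\|F(x)\|\le B/2$ for all $x,y\in X$. Suppose the weak sharpness property holds for $F$ and $X^*$ with parameter $\alpha>0$. Then the extragradient scheme (ESA) generates a sequence $\{x_k\}$ that converges to a solution of SVI$(X,F)$ in an almost sure sense.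
   Context: Let $X\subseteq\mathbb{R}^n$ be nonempty, closed and convex, $\xi:\Omega\to\mathbb{R}^d$ a random vector on a probability space, $F(x;\omega):=F(x,\xi(\omega))\in\mathbb{R}^n$ and $F(x):=\mathbb{E}[F(x;\omega)]$ (componentwise). SVI$(X,F)$ is the problem of finding $x^*\in X$ with $(x-x^* )^TF(x^* )\ge 0$ for all $x\in X$; its solution set is $X^*$. $\Pi_X$ is Euclidean projection onto $X$ and $\|\cdot\|$ is the Euclidean norm. Extragradient stochastic approximation scheme (ESA): given $x_0\in X$ and a positive diminishing steplength sequence $\{\gamma_k\}$, for $k\ge 0$, $$x_{k+1/2}:=\Pi_X\big(x_k-\gamma_k(F(x_k)+w_k)\big),\qquad x_{k+1}:=\Pi_X\big(x_k-\gamma_k(F(x_{k+1/2})+w_{k+1/2})\big),$$ where $\omega_k,\omega_{k+1/2}$ are the samples drawn at iteration $k$, $w_k:=F(x_k;\omega_k)-F(x_k)$ and $w_{k+1/2}:=F(x_{k+1/2};\omega_{k+1/2})-F(x_{k+1/2})$. The histories are $\mathcal F_k:=\sigma\{x_0,\omega_0,\omega_{1/2},\omega_1,\dots,\omega_{k-1/2}\}$ and $\mathcal F_{k+1/2}:=\sigma(\mathcal F_k\cup\{\omega_k\})$. Weak sharpness with parameter $\alpha>0$: $(x-x^* )^TF(x^* )\ge\alpha\min_{z\in X^*}\|x-z\|$ for all $x\in X$ and all $x^*\in X^*$. *)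

(* Defs.v *)
(* Vectors of R^n are columns 'cV[R]_n.  The library topology
   on 'cV[R]_n (product topology, sup norm) is the Euclidean topology, so closed,
   continuous and --> are the usual notions; the library norm `|x| is the sup
   norm, so the Euclidean norm is defined below. *)
From HB Require Import structures.
From mathcomp Require Export all_boot all_order all_algebra.
From mathcomp Require Export all_classical all_reals all_analysis.
Export Order.TTheory GRing.Theory Num.Theory.
Export numFieldNormedType.Exports.

Set Implicit Arguments.
Unset Strict Implicit.
Unset Printing Implicit Defensive.

Local Open Scope classical_set_scope.
Local Open Scope ring_scope.

Definition dotv (R : realType) (n : nat) (u v : 'cV[R]_n) : R :=
  (u^T *m v) ord0 ord0.

Definition enorm (R : realType) (n : nat) (u : 'cV[R]_n) : R :=
  Num.sqrt (dotv u u).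

(* The default value 0 is never used when X is nonempty, closed and convex: the
   minimizer then exists and is unique. *)
Definition proj (R : realType) (n : nat) (X : set 'cV[R]_n) (y : 'cV[R]_n) :
    'cV[R]_n :=
  xget 0 [set p | X p /\ forall z, X z -> enorm (y - p) <= enorm (y - z)].

Definition monotone_on (R : realType) (n : nat) (X : set 'cV[R]_n)
    (F : 'cV[R]_n -> 'cV[R]_n) : Prop :=
  forall x y, X x -> X y -> 0 <= dotv (F x - F y) (x - y).

Definition SVI_sol (R : realType) (n : nat) (X : set 'cV[R]_n)
    (F : 'cV[R]_n -> 'cV[R]_n) : set 'cV[R]_n :=
  [set xs | X xs /\ forall x, X x -> 0 <= dotv (x - xs) (F xs)].

(* The infimum is a minimum whenever the solution set is nonempty and closed,
   as is the case for X closed and F continuous on X. *)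
Definition weak_sharp (R : realType) (n : nat) (X : set 'cV[R]_n)
    (F : 'cV[R]_n -> 'cV[R]_n) (alpha : R) : Prop :=
  forall x xs, X x -> SVI_sol X F xs ->
    alpha * inf [set enorm (x - z) | z in SVI_sol X F] <= dotv (x - xs) (F xs).

Definition borel (U : topologicalType) : set (set U) := <<s @open U >>.

(* Meant for Borel D. *)
Definition borel_measurable_on (U V : topologicalType) (D : set U) (f : U -> V) :
    Prop :=
  forall B : set V, borel B -> borel (D `&` f @^-1` B).

(* Y is a version of the conditional expectation of the integrable variable Z
   given the sigma-algebra G. *)
Definition is_cond_exp (R : realType) (dT : measure_display)
    (T : measurableType dT) (P : probability T R) (G : set (set T))
    (Z Y : T -> R) : Prop :=
  [/\ P.-integrable [set: T] (EFin \o Z),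
      (forall B : set R, measurable B -> G (Y @^-1` B)),
      P.-integrable [set: T] (EFin \o Y) &
      forall A, G A -> (\int[P]_(t in A) (Z t)%:E = \int[P]_(t in A) (Y t)%:E)%E].

(* Almost surely, E[Z | G] satisfies Q.  Two versions agree almost everywhere, so
   it does not matter which one is chosen. *)
Definition cond_exp_as (R : realType) (dT : measure_display)
    (T : measurableType dT) (P : probability T R) (G : set (set T))
    (Z : T -> R) (Q : R -> Prop) : Prop :=
  exists Y : T -> R, is_cond_exp P G Z Y /\ {ae P, forall t, Q (Y t)}.

Definition mean_map (R : realType) (n d : nat) (dO : measure_display)
    (Omega : measurableType dO) (P : probability Omega R)
    (xi : Omega -> 'cV[R]_d) (F : 'cV[R]_n -> 'cV[R]_d -> 'cV[R]_n)
    (x : 'cV[R]_n) : 'cV[R]_n :=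
  \col_i fine 'E_P[fun o => F x (xi o) i ord0].

Definition noise (R : realType) (n d : nat) (dO : measure_display)
    (Omega : measurableType dO) (P : probability Omega R)
    (xi : Omega -> 'cV[R]_d) (F : 'cV[R]_n -> 'cV[R]_d -> 'cV[R]_n)
    (x : 'cV[R]_n) (o : Omega) : 'cV[R]_n :=
  F x (xi o) - mean_map P xi F x.

(* The samples omega_k, omega_{k+1/2} (omega k, omegah k) are random elements of
   Omega on a probability space T carrying the run; x k and xh k are the random
   iterates x_k and x_{k+1/2}. *)
Definition is_ESA (R : realType) (n d : nat) (X : set 'cV[R]_n)
    (dO : measure_display) (Omega : measurableType dO) (P : probability Omega R)
    (xi : Omega -> 'cV[R]_d) (F : 'cV[R]_n -> 'cV[R]_d -> 'cV[R]_n)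
    (gamma : nat -> R) (T : Type) (omega omegah : nat -> T -> Omega)
    (x xh : nat -> T -> 'cV[R]_n) : Prop :=
  forall k t,
    let Fm := mean_map P xi F in
    let w := noise P xi F (x k t) (omega k t) in
    let wh := noise P xi F (xh k t) (omegah k t) in
    xh k t = proj X (x k t - gamma k *: (Fm (x k t) + w)) /\
    x k.+1 t = proj X (x k t - gamma k *: (Fm (xh k t) + wh)).

Definition history (R : realType) (n : nat) (dO : measure_display)
    (Omega : measurableType dO) (T : Type) (x0 : T -> 'cV[R]_n)
    (omega omegah : nat -> T -> Omega) (k : nat) : set (set T) :=
  <<s preimage_set_system [set: T] x0 (@borel 'cV[R]_n) `|`
      \bigcup_(j in [set j | (j < k)%N])
        (preimage_set_system [set: T] (omega j) measurable `|`
         preimage_set_system [set: T] (omegah j) measurable) >>.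

Definition history_half (R : realType) (n : nat) (dO : measure_display)
    (Omega : measurableType dO) (T : Type) (x0 : T -> 'cV[R]_n)
    (omega omegah : nat -> T -> Omega) (k : nat) : set (set T) :=
  <<s history x0 omega omegah k `|`
      preimage_set_system [set: T] (omega k) measurable >>.

(* Main.v *)
Require Import Defs.
From mathcomp Require Import ring lra measurable_realfun.

(** The proof runs through a stochastic quasi-Fejer inequality. Write [S] for the
    solution set, [pi] for the projection on [S], and [y], [z] for the two points
    computed from an iterate [x]. The variational inequalities of the two
    projections, monotonicity and weak sharpness give, for every [v] in [S],

      |z - v|^2 + 2 alpha gamma |x - pi x|
        <= |x - v|^2 + gamma^2 (constant + noise^2) - 2 gamma <w', y - v>,

    where [w'] is the second noise term ([extragradient_step]). Since [w'] has
    mean zero given everything known before its sample is drawn, and [y] and any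
    target [v] chosen in the past are known then, the last term vanishes in the
    mean, over every event of the past on which [x - v] is bounded
    ([noise_orthogonal], [expected_step]). No moment of the initial point is
    available, which is why all expectations are restricted to such events.

    Stopping the inequality when the iterates leave a ball around [v] yields a
    maximal inequality ([maximal_inequality]): started at squared distance at
    most [a] from [v] at time [k], the iterates ever leave the ball of squared
    radius [c] with probability at most [a + C * \sum_(j >= k) gamma_j ^ 2]
    over [c], while the sum of [gamma_j] times the expected distance to [S] stays
    bounded as long as they have not left. As the step lengths are not summable,
    at arbitrarily late times the iterate is close to [S] with probability close
    to one ([dist_small]). Applying the maximal inequality from such a time [k]
    with the random target [v = pi x_k] shows that, almost surely, the iterates
    remain eventually arbitrarily close to a point of [S] ([strays_small],
    [ae_stays_close]). They form a Cauchy sequence, whose limit is in [S] because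
    [S] is closed ([iterates_converge]).

    The random target requires [pi] to be a measurable map: monotonicity makes [S]
    closed and convex by Minty's lemma ([minty]), so [pi] is 1-Lipschitz. *)

Set Implicit Arguments.
Unset Strict Implicit.
Unset Printing Implicit Defensive.

Local Open Scope classical_set_scope.
Local Open Scope ring_scope.

(** * Euclidean norm and projection on a closed convex set *)

Section Euclidean.
Variables (R : realType) (n : nat).
Implicit Types u v w : 'cV[R]_n.

Lemma dotvE u v : dotv u v = \sum_i u i ord0 * v i ord0.
Proof. by rewrite /dotv mxE; apply: eq_bigr => i _; rewrite mxE. Qed.

Lemma dotvC u v : dotv u v = dotv v u.
Proof. by rewrite !dotvE; apply: eq_bigr => i _; rewrite mulrC. Qed.

Lemma dotvDl u v w : dotv (u + v) w = dotv u w + dotv v w.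
Proof. by rewrite /dotv linearD/= mulmxDl mxE. Qed.

Lemma dotvDr u v w : dotv w (u + v) = dotv w u + dotv w v.
Proof. by rewrite dotvC dotvDl !(dotvC w). Qed.

Lemma dotvZl a u w : dotv (a *: u) w = a * dotv u w.
Proof. by rewrite /dotv linearZ/= -scalemxAl mxE. Qed.

Lemma dotvZr a u w : dotv w (a *: u) = a * dotv w u.
Proof. by rewrite dotvC dotvZl dotvC. Qed.

Lemma dotvNl u w : dotv (- u) w = - dotv u w.
Proof. by rewrite -scaleN1r dotvZl mulN1r. Qed.

Lemma dotvNr u w : dotv w (- u) = - dotv w u.
Proof. by rewrite dotvC dotvNl dotvC. Qed.

(** Rewriting rules that expand the inner product of linear combinations. *)
Definition dotv_linear := (dotvDl, dotvDr, dotvNl, dotvNr, dotvZl, dotvZr).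

Lemma dotv_ge0 u : 0 <= dotv u u.
Proof. by rewrite dotvE sumr_ge0// => i _; rewrite -expr2 sqr_ge0. Qed.

Lemma enorm_ge0 u : 0 <= enorm u.
Proof. exact: sqrtr_ge0. Qed.

Lemma enorm_sqr u : enorm u ^+ 2 = dotv u u.
Proof. by rewrite sqr_sqrtr// dotv_ge0. Qed.

Lemma enormN u : enorm (- u) = enorm u.
Proof. by rewrite /enorm dotvNl dotvNr opprK. Qed.

Lemma enormB u v : enorm (u - v) = enorm (v - u).
Proof. by rewrite -enormN opprB. Qed.

Lemma enormZ a u : enorm (a *: u) = `|a| * enorm u.
Proof.
by rewrite /enorm dotvZl dotvZr mulrA -expr2 sqrtrM ?sqr_ge0// sqrtr_sqr.
Qed.

Lemma enorm_coord u i : `|u i ord0| <= enorm u.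
Proof.
rewrite -(@ler_pXn2r _ 2)// ?nnegrE ?enorm_ge0// enorm_sqr real_normK ?num_real//.
rewrite dotvE (bigD1 i)//= -expr2 lerDl sumr_ge0// => j _.
by rewrite -expr2 sqr_ge0.
Qed.

Lemma enorm_eq0 u : enorm u = 0 -> u = 0.
Proof.
move=> u0; apply/matrixP => i j; rewrite (ord1 j) mxE; apply/eqP.
by rewrite -normr_le0 -u0 enorm_coord.
Qed.

Lemma cauchy_schwarz u v : dotv u v <= enorm u * enorm v.
Proof.
have [u0|u0] := eqVneq (enorm u) 0.
  have -> : u = 0 by exact: enorm_eq0.
  by rewrite -(scale0r 0) dotvZl mul0r mulr_ge0 ?enorm_ge0.
have [v0|v0] := eqVneq (enorm v) 0.
  have -> : v = 0 by exact: enorm_eq0.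
  by rewrite -(scale0r 0) dotvZr mul0r mulr_ge0 ?enorm_ge0.
have /= := dotv_ge0 (enorm v *: u - enorm u *: v).
rewrite !dotv_linear -!enorm_sqr (dotvC v u).
have ugt : 0 < enorm u by rewrite lt_neqAle eq_sym u0 enorm_ge0.
have vgt : 0 < enorm v by rewrite lt_neqAle eq_sym v0 enorm_ge0.
have uv : 0 < enorm u * enorm v by rewrite mulr_gt0.
move: (enorm u) (enorm v) (dotv u v) uv => a b c uv H.
rewrite -(ler_pM2l uv); nra.
Qed.

Lemma enormD u v : enorm (u + v) <= enorm u + enorm v.
Proof.
rewrite -(@ler_pXn2r _ 2)// ?nnegrE ?enorm_ge0 ?addr_ge0 ?enorm_ge0//.
rewrite enorm_sqr !dotv_linear (dotvC v u).
have := cauchy_schwarz u v; rewrite sqrrD !enorm_sqr; lra.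
Qed.

Lemma enorm_triangle u v w : enorm (u - w) <= enorm (u - v) + enorm (v - w).
Proof. by apply: le_trans (enormD _ _); rewrite addrA subrK. Qed.

Lemma ballP_enorm u v e : enorm (u - v) < e -> ball u e v.
Proof.
move=> uv; split; first exact: le_lt_trans (enorm_ge0 _) uv.
move=> i j; rewrite (ord1 j) /ball/=; apply: le_lt_trans uv.
by have := enorm_coord (u - v) i; rewrite !mxE.
Qed.

Lemma ball_enorm_le u v e : ball u e v -> enorm (u - v) <= n.+1%:R * e.
Proof.
move=> [e0 uv]; rewrite -(@ler_pXn2r _ 2)// ?nnegrE ?enorm_ge0 ?mulr_ge0 ?(ltW e0)//.
rewrite enorm_sqr dotvE (@le_trans _ _ (\sum_(i < n) e ^+ 2))//.
  apply: ler_sum => i _; have := uv i ord0; rewrite /ball/= => uvi.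
  rewrite -expr2 -[X in X <= _]real_normK ?num_real// ler_pXn2r// ?nnegrE// ?(ltW e0)//.
  by rewrite !mxE; exact: (ltW uvi).
rewrite sumr_const card_ord exprMn -[X in X <= _]mulr_natl.
rewrite ler_wpM2r ?sqr_ge0// -natrX ler_nat (leq_trans (leqnSn n))//.
by rewrite -[X in (X <= _)%N]muln1 leq_mul.
Qed.

(** Neighbourhoods, hence closed sets, limits and Cauchy sequences, can be read
    off the Euclidean norm. *)
Lemma enorm_nbhsP u (A : set 'cV[R]_n) :
  nbhs u A <-> exists2 e : R, 0 < e & forall v, enorm (u - v) < e -> A v.
Proof.
split=> [/nbhs_ballP[e /= e0 eA]|[e e0 eA]].
  exists e => // v uv; exact/eA/ballP_enorm.
apply/nbhs_ballP; exists (e / n.+2%:R) => /=; first by rewrite divr_gt0.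
move=> v /ball_enorm_le uv; apply: eA; apply: le_lt_trans uv _.
rewrite mulrCA gtr_pMr// ltr_pdivrMr// mul1r ltr_nat//.
Qed.

Lemma enorm_closedP (A : set 'cV[R]_n) :
  closed A <->
  forall u, (forall e : R, 0 < e -> exists2 v, A v & enorm (u - v) < e) -> A u.
Proof.
split=> cA u Hu; apply: cA.
  move=> B /enorm_nbhsP[e e0 eB]; have [v Av uv] := Hu _ e0.
  by exists v; split => //; exact: eB.
move=> e e0; have [|v [Av uv]] := Hu [set v | enorm (u - v) < e].
  by apply/enorm_nbhsP; exists e.
by exists v.
Qed.

Lemma enorm_cvgP (x : nat -> 'cV[R]_n) (l : 'cV[R]_n) :
  (x @ \oo --> l) <->
  forall e : R, 0 < e -> exists N, forall k, (N <= k)%N -> enorm (l - x k) < e.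
Proof.
split=> [xl e e0|H A /enorm_nbhsP[e e0 eA]].
  have /xl [N _ NH] : nbhs l [set v | enorm (l - v) < e].
    by apply/enorm_nbhsP; exists e.
  by exists N => k Nk; exact: NH.
by have [N NH] := H _ e0; exists N => // k /= Nk; apply: eA; exact: NH.
Qed.

Lemma enorm_cauchy (x : nat -> 'cV[R]_n) :
  (forall e : R, 0 < e -> exists N, forall i j, (N <= i)%N -> (N <= j)%N ->
     enorm (x i - x j) < e) ->
  exists l : 'cV[R]_n, x @ \oo --> l.
Proof.
move=> xC; apply/cvg_ex; apply: cauchy_cvg; apply: cauchy_exP => e e0.
have [N NH] := xC _ e0; exists (x N), N => // k /= Nk.
by apply: ballP_enorm; exact: NH.
Qed.

End Euclidean.

Lemma lipschitz_continuous (R : realType) (n m : nat)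
    (f : 'cV[R]_n -> 'cV[R]_m) (K : R) :
  (forall u v, enorm (f u - f v) <= K * enorm (u - v)) -> continuous f.
Proof.
move=> fK u A /= /enorm_nbhsP[e e0 eA]; apply/enorm_nbhsP.
have K0 : 0 < `|K| + 1 by rewrite ltr_wpDl.
exists (e / (`|K| + 1)); first by rewrite divr_gt0.
move=> v; rewrite ltr_pdivlMr// => uv; apply: eA; apply: le_lt_trans (fK _ _) _.
apply: le_lt_trans uv; rewrite mulrC ler_wpM2l ?enorm_ge0//.
by apply: le_trans (ler_norm K) _; rewrite lerDl.
Qed.

Lemma enorm_continuous (R : realType) (n : nat) : continuous (@enorm R n).
Proof.
move=> u A /= /nbhs_ballP[e e0 eA]; apply/enorm_nbhsP; exists e => // v uv.
apply: eA; rewrite /ball/=; apply: le_lt_trans uv.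
have := enorm_triangle u v 0; have := enorm_triangle v u 0.
rewrite !subr0 (enormB v u) => H1 H2; rewrite ler_norml; apply/andP; split; lra.
Qed.

Section Projection.
Variables (R : realType) (n : nat) (X : set 'cV[R]_n).
Hypotheses (X_neq0 : X !=set0) (X_closed : closed X) (X_convex : convex_set X).

Lemma convex_segment a b (s : R) :
  X a -> X b -> 0 <= s <= 1 -> X (a + s *: (b - a)).
Proof.
move=> Xa Xb s01.
have /mem_set Xa' := Xa; have /mem_set Xb' := Xb.
have := X_convex (Itv01 (andP s01).1 (andP s01).2) Xb' Xa'.
move=> /set_mem; rewrite /conv/= .
suff -> : s *: b + (1 - s) *: a = a + s *: (b - a) by [].
by rewrite scalerBl scale1r scalerBr addrCA.
Qed.

(** A minimizing sequence is a Cauchy sequence. *)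
Lemma proj_exists (y : 'cV[R]_n) : exists p, X p /\ forall z, X z -> enorm (y - p) <= enorm (y - z).
Proof.
pose D := [set enorm (y - z) | z in X].
have D0 : has_inf D.
  split; first by have [z Xz] := X_neq0; exists (enorm (y - z)), z.
  by exists 0 => _ [z _ <-]; exact: enorm_ge0.
have Dle z : X z -> inf D <= enorm (y - z).
  by move=> Xz; apply: ge_inf; [exact: D0.2|exists z].
have d0 : 0 <= inf D.
  by apply: lb_le_inf; [exact: D0.1|move=> _ [z _ <-]; exact: enorm_ge0].
have zk k : exists z, X z /\ enorm (y - z) < inf D + k.+1%:R^-1.
  have [|_ [z Xz <-] Hz] := @inf_adherent _ D k.+1%:R^-1 _ D0.
    by rewrite invr_gt0.
  by exists z.
have [z zP] := choice zk.
(* by the parallelogram identity at the midpoint, nearly minimal points are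
   close to one another *)
have near_min a b (e : R) : X a -> X b -> 0 < e -> e <= 1 ->
    enorm (y - a) < inf D + e -> enorm (y - b) < inf D + e ->
    enorm (a - b) ^+ 2 <= (8 * inf D + 4) * e.
  move=> Xa Xb e0 e1 Ha Hb.
  have /Dle mid : X (a + 2^-1 *: (b - a)).
    by apply: convex_segment => //; apply/andP; split; lra.
  have para : enorm (a - b) ^+ 2 + 4 * enorm (y - (a + 2^-1 *: (b - a))) ^+ 2 =
      2 * enorm (y - a) ^+ 2 + 2 * enorm (y - b) ^+ 2.
    rewrite !enorm_sqr !dotv_linear (dotvC b a) (dotvC a y) (dotvC b y); lra.
  have := enorm_ge0 (y - a); have := enorm_ge0 (y - b).
  move: para; move: (enorm (y - a)) (enorm (y - b)) (enorm (a - b)) Ha Hb mid.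
  move: (enorm (y - _)) (inf D) d0 => p q q0 r s t Ha Hb mid para s0 r0.
  have : r ^+ 2 <= (q + e) ^+ 2 by rewrite ler_pXn2r ?nnegrE//; lra.
  have : s ^+ 2 <= (q + e) ^+ 2 by rewrite ler_pXn2r ?nnegrE//; lra.
  have : q ^+ 2 <= p ^+ 2 by rewrite ler_pXn2r ?nnegrE//; lra.
  nra.
have [l zl] : exists l : 'cV[R]_n, z @ \oo --> l.
  apply: enorm_cauchy => e e0.
  pose M := 8 * inf D + 4; have M0 : 0 < M by rewrite /M; lra.
  have e2M : 0 < e ^+ 2 / M by rewrite divr_gt0// exprn_gt0.
  have [N _ NH] := near_infty_natSinv_lt (PosNum e2M).
  exists N => i j Ni Nj; rewrite -(@ltr_pXn2r _ 2)// ?nnegrE ?enorm_ge0 ?(ltW e0)//.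
  have e1 : 0 < N.+1%:R^-1 :> R by rewrite invr_gt0.
  have le_inv k : (N <= k)%N -> k.+1%:R^-1 <= N.+1%:R^-1 :> R.
    by move=> Nk; rewrite lef_pV2 ?posrE// ler_nat ltnS.
  apply: (@le_lt_trans _ _ (M * N.+1%:R^-1)).
    apply: near_min => //; [exact: (zP _).1|exact: (zP _).1| | |].
    - by rewrite invf_le1// ler1n.
    - by apply: lt_le_trans (zP i).2 _; rewrite lerD2l le_inv.
    - by apply: lt_le_trans (zP j).2 _; rewrite lerD2l le_inv.
  by have := NH N (leqnn _); rewrite /= ltr_pdivlMr// mulrC.
exists l; split.
  apply: (enorm_closedP X).1 => // e e0; have [N NH] := (enorm_cvgP z l).1 zl e e0.
  by exists (z N); [exact: (zP N).1|exact: NH].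
move=> w /Dle; apply: le_trans; apply/ler_addgt0Pr => e e0.
have /enorm_cvgP zl' := zl.
have e20 : 0 < e / 2 by rewrite divr_gt0.
have [N1 H1] := zl' _ e20.
have [N2 _ H2] := near_infty_natSinv_lt (PosNum e20).
have := H1 _ (leq_maxl N1 N2); have /= := H2 (maxn N1 N2) (leq_maxr N1 N2).
move: (maxn N1 N2) => k.
have := (zP k).2; have := enorm_triangle y (z k) l; rewrite (enormB (z k) l).
suff arith (a b c i q t : R) : a <= b + c -> b < q + i -> i < t / 2 -> c < t / 2 ->
    a <= q + t by exact: arith.
lra.
Qed.

Lemma projP (y : 'cV[R]_n) :
  X (proj X y) /\ forall z, X z -> enorm (y - proj X y) <= enorm (y - z).
Proof. exact: (xgetPex 0 (proj_exists y)). Qed.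

Lemma proj_in y : X (proj X y). Proof. exact: (projP y).1. Qed.

(** The variational characterization of the projection. *)
Lemma proj_var y z : X z -> dotv (y - proj X y) (z - proj X y) <= 0.
Proof.
move=> Xz; have [Xp pmin] := projP y; set p := proj X y in Xp pmin *.
rewrite leNgt; apply/negP => d0.
pose a := dotv (y - p) (z - p); pose b := dotv (z - p) (z - p).
have b0 : 0 <= b by exact: dotv_ge0.
(* the point p + s (z - p) is closer to y for this value of s *)
pose s := a / (a + b).
have ab0 : 0 < a + b by rewrite ltr_wpDr.
have s01 : 0 <= s <= 1.
  by rewrite divr_ge0 ?(ltW d0) ?(ltW ab0)//= ler_pdivrMr// mul1r lerDl.
have /pmin := convex_segment Xp Xz s01.
rewrite -(@ler_pXn2r _ 2)// ?nnegrE ?enorm_ge0// !enorm_sqr opprD addrA.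
have expand (q r : 'cV[R]_n) : dotv (q - s *: r) (q - s *: r) =
    dotv q q - 2 * s * dotv q r + s ^+ 2 * dotv r r.
  by rewrite !dotv_linear (dotvC r q); ring.
rewrite expand -/a -/b; move: (dotv (y - p) (y - p)) => c cle.
have sab : s * (a + b) = a by rewrite divfK// gt_eqF.
have s0 : 0 < s by rewrite divr_gt0.
have : 0 < s * a by rewrite mulr_gt0.
have : s * (2 * a) <= s * (s * b) by lra.
rewrite ler_pM2l//.
have a0 : 0 < a := d0.
clearbody a b s; lra.
Qed.

Lemma proj_lip y z : enorm (proj X y - proj X z) <= enorm (y - z).
Proof.
have := proj_var y (proj_in z); have := proj_var z (proj_in y).
move: (proj X y) (proj X z) => p q Hz Hy.
have : enorm (p - q) ^+ 2 <= dotv (y - z) (p - q).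
  by rewrite enorm_sqr; move: Hz Hy; rewrite !dotv_linear; lra.
have := cauchy_schwarz (y - z) (p - q).
have := enorm_ge0 (p - q); have := enorm_ge0 (y - z).
move: (enorm _) (enorm _) => a b; nra.
Qed.

Lemma proj_id y : X y -> proj X y = y.
Proof.
move=> Xy; have := (projP y).2 _ Xy; rewrite subrr => H.
have : enorm (y - proj X y) = 0.
  apply/eqP; rewrite eq_le enorm_ge0 andbT; apply: le_trans H _.
  by rewrite /enorm -(scale0r 0) dotvZl mul0r sqrtr0.
by move/enorm_eq0/eqP; rewrite subr_eq0 => /eqP.
Qed.

Lemma proj_continuous : continuous (proj X).
Proof. by apply: (@lipschitz_continuous _ _ _ _ 1) => u v; rewrite mul1r proj_lip. Qed.

End Projection.

(** * Monotone variational inequalities and the extragradient step *)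

(** The difference of two vectors of norm at most [B / 2], both perturbed by
    noise. *)
Lemma enorm_sqr_noise (R : realType) (n : nat) (g h w wh : 'cV[R]_n) (B : R) :
  enorm g <= B / 2 -> enorm h <= B / 2 ->
  enorm (g + wh - (h + w)) ^+ 2 <= 3 * B ^+ 2 + 3 * enorm w ^+ 2 + 3 * enorm wh ^+ 2.
Proof.
have -> : g + wh - (h + w) = (g - h) + (wh - w) by rewrite opprD addrACA.
have t1 := enormD (g - h) (wh - w); have t2 := enormD wh (- w).
have t3 := enormD g (- h); rewrite !enormN in t2 t3.
move=> gB hB; move: hB gB.
have := enorm_ge0 (g - h + (wh - w)).
have := enorm_ge0 w; have := enorm_ge0 wh.
move: t1 t2 t3.
move: (enorm (_ + _)) (enorm (g - _)) (enorm (wh - _)) (enorm g)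
  (enorm h) (enorm w) (enorm wh) => a b c d e p q t1 t2 t3 q0 p0 a0 eB dB.
have aB : a <= B + p + q by lra.
have B0 : 0 <= B + p + q by exact: le_trans a0 aB.
have : a ^+ 2 <= (B + p + q) ^+ 2 by rewrite ler_pXn2r.
have sqB r t : 2 * (r * t) <= r ^+ 2 + t ^+ 2 :> R.
  by have := sqr_ge0 (r - t); rewrite sqrrB; lra.
have := sqB B p; have := sqB B q; have := sqB p q; clear.
have -> : (B + p + q) ^+ 2 = B ^+ 2 + p ^+ 2 + q ^+ 2 +
  2 * (B * p) + 2 * (B * q) + 2 * (p * q) by ring.
lra.
Qed.

(** The hypotheses are the variational inequalities for [y] as projection of
    [x - gamma *: g], tested at [z], and for [z] as projection of
    [x - gamma *: h], tested at [v]. *)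
Lemma two_projection_steps (R : realType) (n : nat) (x y z v g h : 'cV[R]_n)
    (gamma : R) :
  dotv (x - gamma *: h - z) (v - z) <= 0 ->
  dotv (x - gamma *: g - y) (z - y) <= 0 ->
  enorm (z - v) ^+ 2 <= enorm (x - v) ^+ 2 - enorm (x - y) ^+ 2
    + gamma ^+ 2 * enorm (h - g) ^+ 2 - 2 * gamma * dotv h (y - v).
Proof.
have xz : x - z = (x - y) + (y - z) by rewrite addrA subrK.
have yv : y - v = (y - z) + (z - v) by rewrite addrA subrK.
have xv : x - v = (x - y) + (y - v) by rewrite addrA subrK.
have sq := dotv_ge0 ((y - z) + gamma *: (g - h)).
move=> Pz Py; move: Pz Py sq; rewrite !enorm_sqr xv yv.
have -> : x - gamma *: h - z = (x - y) + (y - z) - gamma *: h by rewrite addrAC xz.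
have -> : x - gamma *: g - y = (x - y) - gamma *: g by rewrite addrAC.
rewrite -(opprB z v) -(opprB y z).
move: (x - y) (y - z) (z - v) => a b c.
rewrite !dotv_linear (dotvC b a) (dotvC c a) (dotvC c b) (dotvC g b) (dotvC h b) (dotvC h g).
lra.
Qed.

Section VariationalInequality.
Variables (R : realType) (n : nat) (X : set 'cV[R]_n).
Hypotheses (X_neq0 : X !=set0) (X_closed : closed X) (X_convex : convex_set X).
Variables (G : 'cV[R]_n -> 'cV[R]_n) (L : R).
Hypothesis G_mono : monotone_on X G.
Hypothesis L_ge0 : 0 <= L.
Hypothesis G_lip : forall y z, X y -> X z -> enorm (G y - G z) <= L * enorm (y - z).

(** For a monotone Lipschitz map on a convex set, the solutions are the points
    of [X] satisfying inequalities that are affine in [u]; hence the solution set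
    is closed and convex. *)
Lemma minty u :
  SVI_sol X G u <-> X u /\ forall v, X v -> 0 <= dotv (v - u) (G v).
Proof.
split=> -[Xu Hu]; split => // v Xv.
  have := Hu _ Xv; have := G_mono Xv Xu.
  by rewrite (dotvC _ (v - u)) dotvDr dotvNr; lra.
rewrite leNgt; apply/negP => c0.
pose c := dotv (v - u) (G u); pose D := L * enorm (v - u) ^+ 2.
have D0 : 0 <= D by rewrite mulr_ge0// sqr_ge0.
(* moving from u towards v by the fraction s changes the value c of the form by
   at most s * D, and this s satisfies s * D < - c *)
pose s := - c / (D - c).
have Dc0 : 0 < D - c by have : c < 0 := c0; lra.
have s0 : 0 < s by rewrite divr_gt0// oppr_gt0.
have s1 : s <= 1 by rewrite ler_pdivrMr// mul1r; lra.
have Xp : X (u + s *: (v - u)).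
  by apply: convex_segment => //; rewrite (ltW s0) s1.
have := Hu _ Xp; set p := u + _ in Xp *.
have pu : p - u = s *: (v - u) by rewrite /p addrC addKr.
rewrite pu dotvZl pmulr_rge0// => Hp.
have := cauchy_schwarz (v - u) (G p - G u).
have := G_lip Xp Xu; rewrite pu enormZ gtr0_norm// dotvDr dotvNr -/c => H1 H2.
have {H1} : enorm (v - u) * enorm (G p - G u) <= s * D.
  apply: le_trans (ler_wpM2l (enorm_ge0 _) H1) _.
  by rewrite /D -subr_ge0 [X in 0 <= X](_ : _ = 0)//; ring.
have sDc : s * (D - c) = - c by rewrite divfK// gt_eqF.
have : s * c < 0 by rewrite pmulr_rlt0.
move: H2 Hp; move: (dotv _ (G p)) (enorm _ * enorm _) => a b.
clearbody s c D; lra.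
Qed.

Lemma sol_closed : closed (SVI_sol X G).
Proof.
apply/enorm_closedP => u Hu; apply/minty; split.
  apply: (enorm_closedP X).1 => // e /Hu[v [Xv _] uv]; by exists v.
move=> v Xv; apply/ler_addgt0Pr => e e0.
have K0 : 0 < enorm (G v) + 1 by rewrite ltr_wpDl// enorm_ge0.
have [|p /minty[Xp Hp] up] := Hu (e / (enorm (G v) + 1)); first by rewrite divr_gt0.
move: up; rewrite ltr_pdivlMr// => up.
have := cauchy_schwarz (p - u) (- G v); have := Hp _ Xv.
have -> : dotv (v - u) (G v) = dotv (v - p) (G v) + dotv (p - u) (G v).
  by rewrite -dotvDl addrA subrK.
rewrite enormN (enormB p u) dotvNr.
have := enorm_ge0 (u - p).
move: (enorm (u - p)) (enorm (G v)) (dotv _ _) (dotv _ _) up => a b c d.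
lra.
Qed.

Lemma sol_convex : convex_set (SVI_sol X G).
Proof.
move=> /= a b l /set_mem/minty[Xa Ha] /set_mem/minty[Xb Hb]; apply/mem_set/minty.
split; first by apply: set_mem; apply: X_convex; exact: mem_set.
move=> v Xv; have := Ha _ Xv; have := Hb _ Xv.
have l0 : 0 <= l%:num by [].
have l1 : 0 <= 1 - l%:num by rewrite subr_ge0.
rewrite /conv/=.
have -> : v - (l%:num *: a + (1 - l%:num) *: b) =
    l%:num *: (v - a) + (1 - l%:num) *: (v - b).
  by apply/matrixP => i j; rewrite !mxE; ring.
by rewrite [X in _ -> _ -> _ <= X]dotvDl !dotvZl => *; rewrite addr_ge0// mulr_ge0.
Qed.

Variables (alpha B : R).
Hypotheses (alpha_gt0 : 0 < alpha) (sol_neq0 : SVI_sol X G !=set0).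
Hypothesis sharp : weak_sharp X G alpha.
Hypothesis G_bound : forall y, X y -> enorm (G y) <= B / 2.

Notation S := (SVI_sol X G).

(** Weak sharpness at [y], with the distance measured at a nearby point [x]. *)
Lemma sharp_dist x y v : X y -> S v ->
  alpha * (enorm (x - proj S x) - enorm (x - y)) <= dotv (y - v) (G v).
Proof.
move=> Xy Sv; apply: le_trans (sharp Xy Sv); rewrite ler_pM2l//.
apply: lb_le_inf; first by have [s Ss] := sol_neq0; exists (enorm (y - s)), s.
move=> _ [s Ss <-]; rewrite lerBlDl.
apply: le_trans ((projP sol_neq0 sol_closed sol_convex x).2 _ Ss) _.
exact: enorm_triangle.
Qed.

(** One extragradient step: up to a noise term of mean zero and an error of
    order [gamma ^+ 2], the squared distance to a solution [v] decreases by a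
    multiple of the distance to the solution set. *)
Lemma extragradient_step (x v w wh : 'cV[R]_n) (gamma : R) :
  0 < gamma -> X x -> S v ->
  let y := proj X (x - gamma *: (G x + w)) in
  let z := proj X (x - gamma *: (G y + wh)) in
  enorm (z - v) ^+ 2 + 2 * alpha * gamma * enorm (x - proj S x) <=
  enorm (x - v) ^+ 2
  + gamma ^+ 2 * (alpha ^+ 2 + 3 * B ^+ 2 + 3 * enorm w ^+ 2 + 3 * enorm wh ^+ 2)
  - 2 * gamma * dotv wh (y - v).
Proof.
move=> g0 Xx Sv /=; set y := proj X (x - gamma *: (G x + w)).
set z := proj X (x - gamma *: (G y + wh)).
have Xy : X y by exact: proj_in.
have Xz : X z by exact: proj_in.
have Pz : dotv (x - gamma *: (G y + wh) - z) (v - z) <= 0 by apply: proj_var => //; exact: Sv.1.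
have Py : dotv (x - gamma *: (G x + w) - y) (z - y) <= 0 by exact: proj_var.
have dec : enorm (z - v) ^+ 2 <= enorm (x - v) ^+ 2 - enorm (x - y) ^+ 2
    + gamma ^+ 2 * enorm (G y + wh - (G x + w)) ^+ 2 - 2 * gamma * dotv (G y + wh) (y - v).
  exact: two_projection_steps.
have err : enorm (G y + wh - (G x + w)) ^+ 2 <=
    3 * B ^+ 2 + 3 * enorm w ^+ 2 + 3 * enorm wh ^+ 2.
  by apply: enorm_sqr_noise; exact: G_bound.
have gain : alpha * (enorm (x - proj S x) - enorm (x - y)) <= dotv (G y) (y - v).
  apply: le_trans (sharp_dist x Xy Sv) _.
  rewrite (dotvC (y - v)) -subr_ge0 -dotvNl -dotvDl.
  exact: G_mono Xy Sv.1.
have hE : dotv (G y + wh) (y - v) = dotv (G y) (y - v) + dotv wh (y - v) by rewrite dotvDl.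
rewrite hE in dec.
have := sqr_ge0 (enorm (x - y) - gamma * alpha).
have := ler_wpM2l (ltW g0) gain.
have := ler_wpM2l (sqr_ge0 gamma) err.
move: dec.
move: (enorm (z - v)) (enorm (x - v)) (enorm (x - y)) (enorm (_ - (G x + w)))
  (enorm (x - proj S x)) (dotv (G y) _) (dotv wh _) (enorm w) (enorm wh).
clear => a b c d e f h p q *; lra.
Qed.

End VariationalInequality.

(** * Measurability of random vectors *)

(** A random vector is measurable when its coordinates are. *)
Definition coord_measurable (R : realType) (n : nat) (dT : measure_display)
    (T : measurableType dT) (f : T -> 'cV[R]_n) : Prop :=
  forall i, measurable_fun [set: T] (fun t => f t i ord0).

Lemma borel_open (U : topologicalType) (O : set U) : open O -> borel O.
Proof. by move=> oO; exact: sub_sigma_algebra. Qed.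

(** It suffices to check measurability on open sets. *)
Lemma borel_preimage (U : topologicalType) (dT : measure_display)
    (T : measurableType dT) (f : T -> U) :
  (forall O, open O -> measurable (f @^-1` O)) ->
  forall B, borel B -> measurable (f @^-1` B).
Proof.
move=> fO; apply: smallest_sub => //; split.
- by rewrite preimage_set0.
- by move=> A mA; rewrite setTD preimage_setC; exact: measurableC.
- by move=> A mA; rewrite preimage_bigcup; exact: bigcupT_measurable.
Qed.

Section CoordMeasurable.
Variables (R : realType) (n m : nat) (dT : measure_display) (T : measurableType dT).

Lemma rat_approx (k : nat) (u : 'cV[R]_k) (e : R) : 0 < e ->
  exists q : 'cV[rat]_k, forall i, `|u i ord0 - ratr (q i ord0)| < e.
Proof.
move=> e0.
have H (i : 'I_k) : exists q : rat, `|u i ord0 - ratr q| < e.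
  have /rat_in_itvoo[q] : u i ord0 - e < u i ord0 + e by lra.
  rewrite in_itv/= => /andP[q1 q2]; exists q; rewrite ltr_norml; apply/andP; lra.
have [q qP] := choice H; exists (\col_i q i) => i; by rewrite mxE.
Qed.

Lemma box_measurable (k : nat) (f : T -> 'cV[R]_k) (q : 'cV[rat]_k) (e : R) :
  coord_measurable f ->
  measurable [set t | forall i, `|f t i ord0 - ratr (q i ord0)| < e].
Proof.
move=> mf.
rewrite (_ : [set t | _] = \big[setI/setT]_(i < k)
    ((fun t => f t i ord0) @^-1` `]ratr (q i ord0) - e, ratr (q i ord0) + e[)).
  apply: bigsetI_measurable => i _; rewrite -[X in measurable X]setTI; exact: mf.
rewrite -bigcap_seq; apply/seteqP; split=> [t /= Ht i _|t /= Ht i].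
  have := Ht i; rewrite /= in_itv/=; rewrite ltr_norml => /andP[h1 h2].
  by apply/andP; split; lra.
have /= := Ht i (mem_index_enum i); rewrite in_itv/= => /andP[h1 h2].
by rewrite ltr_norml; apply/andP; split; lra.
Qed.

(** Open sets of the product are countable unions of rational boxes. *)
Lemma pair_open (f : T -> 'cV[R]_n) (g : T -> 'cV[R]_m) O :
  coord_measurable f -> coord_measurable g -> open O ->
  measurable ((fun t => (f t, g t)) @^-1` O).
Proof.
move=> mf mg oO.
pose J := ('cV[rat]_n * 'cV[rat]_m * nat)%type.
pose inv (j : J) : R := j.2.+1%:R^-1.
pose box1 (j : J) : set 'cV[R]_n := [set u | forall i, `|u i ord0 - ratr (j.1.1 i ord0)| < inv j].
pose box2 (j : J) : set 'cV[R]_m := [set u | forall i, `|u i ord0 - ratr (j.1.2 i ord0)| < inv j].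
pose good (j : J) := `[< box1 j `*` box2 j `<=` O >].
rewrite (_ : _ @^-1` O = \bigcup_(j : J)
    (if good j then (f @^-1` box1 j) `&` (g @^-1` box2 j) else set0)).
  apply: countable_bigcupT_measurable; first exact: (@countableP J).
  move=> j; case: ifP => // _.
  by apply: measurableI; exact: box_measurable.
have close2 (a b c i s : R) :
    `|a - c| < i -> `|b - c| < i -> i < s / 2 -> `|a - b| < s.
  rewrite !ltr_norml => /andP[h1 h2] /andP[h3 h4] h5.
  by apply/andP; split; lra.
apply/seteqP; split=> t /=.
  move=> Ot; have /nbhs_ballP[e /= e0 eO] := open_nbhs_nbhs (conj oO Ot).
  have e20 : 0 < e / 2 by rewrite divr_gt0.
  have [N _ /(_ N (leqnn N))/= HN] := near_infty_natSinv_lt (PosNum e20).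
  have N0 : 0 < N.+1%:R^-1 :> R by rewrite invr_gt0.
  have [p Hp] := rat_approx (f t) N0.
  have [q Hq] := rat_approx (g t) N0.
  exists (p, q, N) => //; rewrite ifT//; apply/asboolP => -[u v] [/= Hu Hv].
  apply: eO; split; split=> // i j; rewrite (ord1 j) /ball/=.
    exact: (close2 _ _ _ _ _ (Hp i) (Hu i) HN).
  exact: (close2 _ _ _ _ _ (Hq i) (Hv i) HN).
move=> [j _]; case: ifP => // /asboolP Hj [h1 h2].
by apply: Hj; split.
Qed.

Lemma pair_borel (f : T -> 'cV[R]_n) (g : T -> 'cV[R]_m) B :
  coord_measurable f -> coord_measurable g -> borel B ->
  measurable ((fun t => (f t, g t)) @^-1` B).
Proof.
move=> mf mg; apply: borel_preimage => O; exact: pair_open.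
Qed.

End CoordMeasurable.

Section CoordMeasurableOps.
Variables (R : realType) (dT : measure_display) (T : measurableType dT).

Lemma coord_measurable_open n (f : T -> 'cV[R]_n) O :
  coord_measurable f -> open O -> measurable (f @^-1` O).
Proof.
move=> mf oO.
have -> : f @^-1` O = (fun t => (f t, (0 : 'cV[R]_0))) @^-1` (fst @^-1` O) by [].
have m0 : coord_measurable (fun _ : T => 0 : 'cV[R]_0) by case.
apply: (pair_open mf m0).
by apply: open_comp => // p _; exact: cvg_fst.
Qed.

Lemma coord_measurable_cont_real n (f : T -> 'cV[R]_n) (phi : 'cV[R]_n -> R) :
  coord_measurable f -> continuous phi -> measurable_fun [set: T] (phi \o f).
Proof.
move=> mf cphi; apply: (measurability _ (RGenOInfty.measurableE R)) => //.
move=> _ [_ [a ->] <-]; rewrite setTI comp_preimage.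
apply: coord_measurable_open => //; apply: open_comp => //.
Qed.

Lemma borel_coord_measurable n (f : T -> 'cV[R]_n) :
  (forall B, borel B -> measurable (f @^-1` B)) -> coord_measurable f.
Proof.
move=> fB i; apply: (measurability _ (RGenOInfty.measurableE R)) => //.
move=> _ [_ [a ->] <-]; rewrite setTI.
have /fB : borel ((fun u : 'cV[R]_n => u i ord0) @^-1` `]a, +oo[).
  apply: borel_open; apply: open_comp => // u _; exact: coord_continuous.
by [].
Qed.

Lemma coord_measurable_cont n m (f : T -> 'cV[R]_n) (phi : 'cV[R]_n -> 'cV[R]_m) :
  coord_measurable f -> continuous phi -> coord_measurable (phi \o f).
Proof.
move=> mf cphi i.
apply: (coord_measurable_cont_real (phi := (fun u : 'cV[R]_m => u i ord0) \o phi)) => //.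
by move=> u; apply: continuous_comp; [exact: cphi|exact: coord_continuous].
Qed.

(** Composition with a map that is Borel only when its first argument is
    restricted to [X]. *)
Lemma coord_measurable_borel_on n m k (X : set 'cV[R]_n)
    (F : 'cV[R]_n -> 'cV[R]_m -> 'cV[R]_k) (f : T -> 'cV[R]_n) (g : T -> 'cV[R]_m) :
  borel_measurable_on (X `*` [set: 'cV[R]_m])
    (fun p : 'cV[R]_n * 'cV[R]_m => F p.1 p.2) ->
  (forall t, X (f t)) -> coord_measurable f -> coord_measurable g ->
  coord_measurable (fun t => F (f t) (g t)).
Proof.
move=> mF Xf mf mg; apply: borel_coord_measurable => B /mF bB.
have := pair_borel mf mg bB; congr (measurable _).
by apply/seteqP; split=> t /= => [[]|].
Qed.

Lemma coord_measurableB n (f g : T -> 'cV[R]_n) :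
  coord_measurable f -> coord_measurable g -> coord_measurable (fun t => f t - g t).
Proof.
move=> mf mg i; rewrite (_ : (fun t => _) = (fun t => f t i ord0) \- (fun t => g t i ord0)).
  exact: measurable_funB.
by apply: funext => t; rewrite !mxE.
Qed.

Lemma coord_measurableZ n (a : R) (f : T -> 'cV[R]_n) :
  coord_measurable f -> coord_measurable (fun t => a *: f t).
Proof.
move=> mf i; rewrite (_ : (fun t => _) = (fun t => a * f t i ord0)).
  exact: measurable_funM.
by apply: funext => t; rewrite !mxE.
Qed.

Lemma measurable_enorm n (f : T -> 'cV[R]_n) :
  coord_measurable f -> measurable_fun [set: T] (fun t => enorm (f t)).
Proof.
by move=> mf; apply: (coord_measurable_cont_real mf); exact: enorm_continuous.
Qed.

End CoordMeasurableOps.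

Lemma coord_measurable_comp (R : realType) n d1 d2 (T1 : measurableType d1)
    (T2 : measurableType d2) (phi : T2 -> T1) (f : T1 -> 'cV[R]_n) :
  measurable_fun [set: T2] phi -> coord_measurable f -> coord_measurable (f \o phi).
Proof. by move=> mphi mf i; exact: (measurableT_comp (mf i) mphi). Qed.

(** * Conditional expectations *)

Section CondExp.
Import HBSimple HBNNSimple.
Variables (R : realType) (dT : measure_display) (T : measurableType dT).
Variable Pr : probability T R.
Variable M : set (set T).
Hypothesis M_sub : <<s M >> `<=` measurable.

(** Measurability with respect to the sub-sigma-algebra generated by [M]. *)
Definition sub_measurable (f : T -> R) :=
  @measurable_fun _ _ (g_sigma_algebraType M) _ [set: T] f.

Lemma id_sub_measurable :
  @measurable_fun _ _ T (g_sigma_algebraType M) [set: T] id.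
Proof. by move=> _ B mB; rewrite setTI; exact: M_sub. Qed.

Lemma sub_measurableW f : sub_measurable f -> measurable_fun [set: T] f.
Proof. by move=> mf; exact: (measurableT_comp mf id_sub_measurable). Qed.

Variable Z : T -> R.
Hypothesis Z_int : Pr.-integrable [set: T] (EFin \o Z).
Hypothesis Z_mean0 : forall A, <<s M >> A -> (\int[Pr]_(t in A) (Z t)%:E = 0)%E.

(** The case of a simple function: expand it over its level sets. *)
Lemma ortho_simple (g : {nnsfun (g_sigma_algebraType M) >-> R}) E :
  <<s M >> E -> (\int[Pr]_(t in E) (Z t * (g : T -> R) t)%:E = 0)%E.
Proof.
move=> FE; have mE := M_sub FE.
pose s : seq R := finmap.enum_fset (fset_set (range g)).
pose A (i : nat) : set T := (g : T -> R) @^-1` [set s`_i].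
have FA i : <<s M >> (A i).
  have := @measurable_funPTI _ _ _ _ g _ (measurable_set1 s`_i); exact.
have mA i : measurable (A i) := M_sub (FA i).
have iZA i : Pr.-integrable E (fun t => (Z t * \1_(A i) t)%:E).
  have := integrableS measurableT mE (@subsetT _ _)
    ((integrable_mkcond (EFin \o Z) (mA i)).1
      (integrableS measurableT (mA i) (@subsetT _ _) Z_int)).
  apply: eq_integrable => // t _ /=; rewrite patchE indicE.
  by case: ifPn => _; rewrite ?mulr1 ?mulr0.
have iA i : Pr.-integrable E (fun t => (s`_i * (Z t * \1_(A i) t))%:E).
  by under eq_fun do rewrite EFinM; exact: integrableZl.
transitivity (\int[Pr]_(t in E) (\sum_(i < size s) (s`_i * (Z t * \1_(A i) t))%:E))%E.
  apply: eq_integral => t _; rewrite sumEFin [X in Z t * X]fimfunEord mulr_sumr.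
  congr EFin; apply: eq_bigr => i _. exact: mulrCA.
rewrite (integral_sum mE (f := fun (i : 'I_(size s)) t => (s`_i * (Z t * \1_(A i) t))%:E))//.
rewrite big1// => i _.
under eq_integral do rewrite EFinM.
rewrite integralZl//.
rewrite [X in (_ * X)%E](_ : _ = 0%E) ?mule0//.
rewrite -[RHS](Z_mean0 (A := E `&` A i)).
  rewrite integral_mkcondr; apply: eq_integral => t _; rewrite /= patchE indicE.
  by case: (t \in A i); [rewrite mulr1|rewrite mulr0].
exact: (@measurableI _ (g_sigma_algebraType M) E (A i) FE (FA i)).
Qed.

(** Dominated convergence along simple functions increasing to [Y]. *)
Lemma ortho_ge0 (Y : T -> R) E : <<s M >> E -> sub_measurable Y ->
  (forall t, 0 <= Y t) -> Pr.-integrable E (fun t => (Z t * Y t)%:E) ->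
  (\int[Pr]_(t in E) (Z t * Y t)%:E = 0)%E.
Proof.
move=> FE mY Y0 iZY; have mE := M_sub FE.
have mYe : measurable_fun [set: g_sigma_algebraType M] (EFin \o Y).
  exact/measurable_EFinP.
pose g := nnsfun_approx measurableT mYe.
have gcvge t : (EFin \o g ^~ t) @ \oo --> (Y t)%:E.
  by apply: cvg_nnsfun_approx => // u _; rewrite lee_fin.
have gcvg t : (fun k => g k t) @ \oo --> Y t by exact: (fine_cvg (gcvge t)).
have gle k t : g k t <= Y t.
  rewrite -(cvg_lim _ (gcvg t))//.
  apply: (@nondecreasing_cvgn_le _ (fun k => g k t)) => [a b ab|].
    by have /lefP := nd_nnsfun_approx measurableT mYe ab; exact.
  by apply/cvg_ex; exists (Y t).
have mZ : measurable_fun E Z.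
  apply: (measurable_funS measurableT) => //.
  by apply/measurable_EFinP; exact: measurable_int Z_int.
have mg k : measurable_fun E (g k : T -> R).
  apply: (measurable_funS measurableT) => //.
  by apply: sub_measurableW; exact: measurable_funPT.
have Zgcvg t : E t -> (fun k => (Z t * g k t)%:E) @ \oo --> (Z t * Y t)%:E.
  move=> _; apply: cvg_EFin; first exact: nearW.
  exact: (cvgMl_tmp (gcvg t)).
have dom t k : E t -> (`|(Z t * g k t)%:E| <= `|(Z t * Y t)%:E|)%E.
  move=> _; rewrite /= lee_fin !normrM ler_wpM2l//.
  rewrite !ger0_norm//; exact: fun_ge0.
have [_ _] := @dominated_convergence _ T R Pr E mE
  (fun k t => (Z t * g k t)%:E) (fun t => (Z t * Y t)%:E)
  (fun t => `|(Z t * Y t)%:E|%E)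
  (fun k => (measurable_EFinP _ _).2 (measurable_funM mZ (mg k)))
  (measurable_int _ iZY) (aeW _ Zgcvg) (integrable_abse iZY) (aeW _ dom).
rewrite [X in X @ _ --> _](_ : _ = cst 0%E); last first.
  by apply/funext => k; exact: ortho_simple.
by move=> /cvg_lim <- //; exact: lim_cst.
Qed.

(** A conditionally centred variable is orthogonal to every random variable
    that the conditioning sigma-algebra measures. *)
Lemma ortho (Y : T -> R) E : <<s M >> E -> sub_measurable Y ->
  Pr.-integrable E (fun t => (Z t * Y t)%:E) ->
  (\int[Pr]_(t in E) (Z t * Y t)%:E = 0)%E.
Proof.
move=> FE mY iZY; have mE := M_sub FE.
have mZ : measurable_fun E Z.
  apply: (measurable_funS measurableT) => //.
  by apply/measurable_EFinP; exact: measurable_int Z_int.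
have iZ (Y' : T -> R) : sub_measurable Y' -> (forall t, `|Y' t| <= `|Y t|) ->
    Pr.-integrable E (fun t => (Z t * Y' t)%:E).
  move=> mY' Y'Y; apply: le_integrable iZY => //.
    apply/measurable_EFinP; apply: measurable_funM => //.
    by apply: (measurable_funS measurableT) => //; exact: sub_measurableW.
  by move=> t _; rewrite /= lee_fin !normrM ler_wpM2l.
pose Yp t := Num.max (Y t) 0; pose Yn t := Num.max (- Y t) 0.
have mYp : sub_measurable Yp by apply: measurable_maxr.
have mYn : sub_measurable Yn by apply: measurable_maxr => //; exact: measurableT_comp.
have Yp_ge0 t : 0 <= Yp t by rewrite /Yp le_max lexx orbT.
have Yn_ge0 t : 0 <= Yn t by rewrite /Yn le_max lexx orbT.
have iYp : Pr.-integrable E (fun t => (Z t * Yp t)%:E).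
  apply: iZ => // t; rewrite ger0_norm// /Yp ge_max normr_ge0 andbT; exact: ler_norm.
have iYn : Pr.-integrable E (fun t => (Z t * Yn t)%:E).
  apply: iZ => // t; rewrite ger0_norm// /Yn ge_max normr_ge0 andbT -normrN.
  exact: ler_norm.
transitivity (\int[Pr]_(t in E) ((Z t * Yp t)%:E - (Z t * Yn t)%:E))%E.
  apply: eq_integral => t _; rewrite -EFinB -mulrBr; congr (_ * _)%:E.
  rewrite /Yp /Yn; have [Yt|/ltW Yt] := lerP 0 (Y t).
    by rewrite max_r ?oppr_le0// subr0.
  by rewrite max_l ?oppr_ge0// sub0r opprK.
by rewrite integralB// !ortho_ge0// sube0.
Qed.

End CondExp.

Section CondExpBounds.
Variables (R : realType) (dT : measure_display) (T : measurableType dT).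
Variables (Pr : probability T R) (G : set (set T)).
Hypothesis G_sub : G `<=` measurable.

Lemma cond_exp_mean0 (Z : T -> R) :
  cond_exp_as Pr G Z (fun y => y = 0) ->
  Pr.-integrable [set: T] (EFin \o Z) /\
  forall A, G A -> (\int[Pr]_(t in A) (Z t)%:E = 0)%E.
Proof.
move=> [Y [[iZ _ iY eZY] Y0]]; split => // A GA.
have mA := G_sub GA.
rewrite eZY// (ae_eq_integral (cst 0%E))//.
- by rewrite integral0.
- by apply: measurable_funS (measurable_int _ iY).
- by apply: filterS Y0 => t /= -> _.
Qed.

Lemma cond_exp_le (Z : T -> R) (b : R) :
  cond_exp_as Pr G Z (fun y => y <= b) ->
  Pr.-integrable [set: T] (EFin \o Z) /\
  forall A, G A -> \int[Pr]_(t in A) Z t <= b * fine (Pr A).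
Proof.
move=> [Y [[iZ _ iY eZY] Yb]]; split => // A GA.
have mA := G_sub GA.
rewrite /Rintegral eZY// -lee_fin.
have iYA : Pr.-integrable A (EFin \o Y) by exact: integrableS iY.
rewrite fineK; last exact: integrable_fin_num.
rewrite EFinM fineK; last exact: fin_num_measure.
rewrite -integral_cst//.
have mY : measurable_fun A Y by apply/measurable_EFinP; exact: measurable_int iYA.
have mYb : measurable_fun A (fun t => Num.min (Y t) b).
  by apply: measurable_minr => //; exact: measurable_cst.
(* truncating the version at b changes it on a null set only *)
rewrite [X in (X <= _)%E](ae_eq_integral (fun t => (Num.min (Y t) b)%:E))//.
- apply: le_integral => //.
  + apply: (@le_integrable _ _ _ _ _ mA _ (fun t => (`|Y t| + `|b|)%:E)).
    * exact/measurable_EFinP.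
    * move=> t _; rewrite /= lee_fin (ger0_norm (addr_ge0 _ _))//.
      by rewrite /Num.min; case: ifP => _; [rewrite lerDl|rewrite lerDr].
    * under eq_fun do rewrite EFinD; apply: integrableD => //.
        exact: (integrable_abse iYA).
      exact: finite_measure_integrable_cst.
  + exact: finite_measure_integrable_cst.
  + by move=> t _; rewrite lee_fin ge_min lexx orbT.
- exact/measurable_EFinP.
- exact/measurable_EFinP.
- by apply: filterS Yb => t /= tb _; rewrite min_l.
Qed.

End CondExpBounds.

(** * Series with nonnegative terms *)

Section Series.
Variables (R : realType) (u : nat -> R).
Hypothesis u_ge0 : forall k, 0 <= u k.

Lemma partial_sum_mono i j : (i <= j)%N -> \sum_(k < i) u k <= \sum_(k < j) u k.
Proof.
move=> /subnKC <-; rewrite big_split_ord/= lerDl; exact: sumr_ge0.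
Qed.

Lemma summable_bounded :
  (\sum_(0 <= k <oo) (u k)%:E < +oo)%E -> exists Q, forall N, \sum_(k < N) u k <= Q.
Proof.
move=> ufin; exists (fine (\sum_(0 <= k <oo) (u k)%:E)%E) => N.
have s0 : (0 <= \sum_(0 <= k <oo) (u k)%:E)%E.
  by apply: nneseries_ge0 => k _ _; rewrite lee_fin.
rewrite -lee_fin fineK; last by rewrite ge0_fin_numE.
rewrite -sumEFin -(big_mkord xpredT (fun k => (u k)%:E)).
by apply: nneseries_lim_ge => k _; rewrite lee_fin.
Qed.

Lemma summable_tail (e : R) :
  (\sum_(0 <= k <oo) (u k)%:E < +oo)%E -> 0 < e ->
  exists K, forall k N, (K <= k)%N -> \sum_(j < N) u (k + j)%N <= e.
Proof.
move=> /summable_bounded[Q HQ] e0.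
pose D := range (fun N => \sum_(k < N) u k).
have D0 : has_sup D.
  by split; [exists (\sum_(k < 0) u k), 0%N|exists Q => _ [N _ <-]].
have [_ [K _ <-] HK] := sup_adherent e0 D0.
exists K => k N Kk.
have : \sum_(j < k + N) u j <= sup D by apply: ub_le_sup; [exact: D0.2|exists (k + N)%N].
rewrite big_split_ord/=; have := partial_sum_mono Kk.
move: HK; move: (\sum_(j < K) _) (\sum_(j < k) _) (\sum_(j < N) _) (sup D) => *.
lra.
Qed.

Lemma divergent_large (A : R) :
  (\sum_(0 <= k <oo) (u k)%:E = +oo)%E -> exists N, A < \sum_(k < N) u k.
Proof.
move=> uoo; apply: contrapT => /forallNP H.
suff : (\sum_(0 <= k <oo) (u k)%:E <= A%:E)%E by rewrite uoo leNgt ltry.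
apply: lime_le; first by apply: is_cvg_nneseries => k _ _; rewrite lee_fin.
apply: nearW => N; rewrite /= big_mkord sumEFin lee_fin leNgt.
by apply/negP; exact: H.
Qed.

End Series.

(** * Probabilities as real numbers *)

Section Probability.
Variables (R : realType) (dT : measure_display) (T : measurableType dT).
Variable Pr : probability T R.
Implicit Types A B : set T.

(** The probability of an event as a real number. *)
Definition prob A : R := fine (Pr A).

Lemma probE A : measurable A -> Pr A = (prob A)%:E.
Proof. by move=> mA; rewrite fineK// fin_num_measure. Qed.

Lemma prob_ge0 A : 0 <= prob A. Proof. by rewrite fine_ge0. Qed.

Lemma prob_le1 A : measurable A -> prob A <= 1.
Proof. by move=> mA; rewrite -lee_fin -probE// probability_le1. Qed.

Lemma prob_le A B : measurable A -> measurable B -> A `<=` B -> prob A <= prob B.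
Proof. by move=> mA mB AB; rewrite -lee_fin -!probE// le_measure ?inE. Qed.

Lemma probU_le A B : measurable A -> measurable B ->
  prob (A `|` B) <= prob A + prob B.
Proof.
move=> mA mB; rewrite -lee_fin EFinD -!probE//; first exact: measureU2.
exact: measurableU.
Qed.

Lemma probDI A B : measurable A -> measurable B ->
  prob A = prob (A `\` B) + prob (A `&` B).
Proof.
move=> mA mB; apply: EFin_inj; rewrite EFinD -!probE//; first exact: measureDI.
- exact: measurableI.
- exact: measurableD.
Qed.

Lemma prob_setC A : measurable A -> prob (~` A) = 1 - prob A.
Proof.
move=> mA; apply: EFin_inj; rewrite EFinB -!probE ?probability_setC//.
exact: measurableC.
Qed.

Lemma prob_bigcup_le (A : nat -> set T) (e : R) :
  (forall i, measurable (A i)) -> nondecreasing_seq A -> (forall i, prob (A i) <= e) ->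
  prob (\bigcup_i A i) <= e.
Proof.
move=> mA ndA Ae; have mU : measurable (\bigcup_i A i) by exact: bigcupT_measurable.
have cvA := nondecreasing_cvg_mu (mu := Pr) mA mU ndA.
rewrite -lee_fin -probE// -(cvg_lim _ cvA)//.
apply: lime_le; first by apply/cvg_ex; eexists; exact: cvA.
by apply: nearW => i; rewrite /= probE// lee_fin.
Qed.

Lemma prob_cover (A : nat -> set T) (e : R) :
  (forall i, measurable (A i)) -> nondecreasing_seq A -> \bigcup_i A i = setT ->
  0 < e -> exists i, prob (~` A i) <= e.
Proof.
move=> mA ndA covA e0; apply: contrapT => /forallNP H.
have : prob (\bigcup_i A i) <= 1 - e.
  apply: prob_bigcup_le => // i; have /negP := H i; rewrite -ltNge prob_setC//; lra.
by rewrite covA /prob probability_setT/=; lra.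
Qed.

Lemma Rintegral_ge_prob A (f : T -> R) (c : R) : measurable A ->
  Pr.-integrable A (EFin \o f) -> (forall t, A t -> c <= f t) ->
  c * prob A <= \int[Pr]_(t in A) f t.
Proof.
move=> mA fi fc; rewrite -Rintegral_cst//; apply: le_Rintegral => //.
exact: finite_measure_integrable_cst.
Qed.

Lemma Rintegral_le_prob A (f : T -> R) (c : R) : measurable A ->
  Pr.-integrable A (EFin \o f) -> (forall t, A t -> f t <= c) ->
  \int[Pr]_(t in A) f t <= c * prob A.
Proof.
move=> mA fi fc; rewrite -Rintegral_cst//; apply: le_Rintegral => //.
exact: finite_measure_integrable_cst.
Qed.

End Probability.

(** * Convergence of the stochastic extragradient iterates *)

(** The elementary bound behind the integrability of the noise term, with [p]
    and [q] the factors, [W] and [c] the noise norms, [s] and [r] the lengths of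
    the two sides of a triangle. *)
Lemma product_dominated (R : realType) (p q W c r s d g b a : R) :
  0 <= p -> 0 <= q -> p <= W -> q <= d -> d <= s + r -> 0 <= s -> 0 <= r ->
  s <= g * (b / 2 + c) -> r ^+ 2 <= a ->
  p * q <= W ^+ 2 + (4 * g ^+ 2 * c ^+ 2 + (g ^+ 2 * b ^+ 2 + 2 * a)).
Proof.
move=> p0 q0 pW qd dsr s0 r0 sgw ra.
have e1 : p * q <= p ^+ 2 + q ^+ 2.
  have := sqr_ge0 (p - q); have := sqr_ge0 (p + q); rewrite sqrrB sqrrD; lra.
have e2 : p ^+ 2 <= W ^+ 2 by rewrite ler_pXn2r ?nnegrE//; lra.
have e3 : q ^+ 2 <= (s + r) ^+ 2 by rewrite ler_pXn2r ?nnegrE//; lra.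
have e4 : s ^+ 2 <= (g * (b / 2 + c)) ^+ 2.
  by rewrite ler_pXn2r ?nnegrE//; exact: le_trans s0 sgw.
have e5 : (s + r) ^+ 2 <= 2 * s ^+ 2 + 2 * r ^+ 2.
  by have := sqr_ge0 (s - r); rewrite sqrrB sqrrD; lra.
have e6 : 2 * (g * (b / 2 + c)) ^+ 2 <= 4 * g ^+ 2 * c ^+ 2 + g ^+ 2 * b ^+ 2.
  rewrite exprMn; have := mulr_ge0 (sqr_ge0 g) (sqr_ge0 (b / 2 - c)).
  lra.
lra.
Qed.

(** The induction step of the maximal inequality below, as an inequality between
    numbers. *)
Lemma telescoping_arith (R : realType) (a p p1 i i1 i2 s1 s2 d g c : R) :
  p + i + s1 <= a + c * s2 -> i1 + i2 + d <= i + g * c -> p1 <= i2 ->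
  p + p1 + i1 + (s1 + d) <= a + c * (s2 + g).
Proof. lra. Qed.

Section StochasticExtragradient.
Variables (R : realType) (n : nat) (X : set 'cV[R]_n).
Hypotheses (X_neq0 : X !=set0) (X_closed : closed X) (X_convex : convex_set X).
Variables (G : 'cV[R]_n -> 'cV[R]_n) (L alpha B : R).
Hypothesis G_mono : monotone_on X G.
Hypothesis L_ge0 : 0 <= L.
Hypothesis G_lip : forall y z, X y -> X z -> enorm (G y - G z) <= L * enorm (y - z).
Hypotheses (alpha_gt0 : 0 < alpha) (sol_neq0 : SVI_sol X G !=set0).
Hypothesis sharp : weak_sharp X G alpha.
Hypothesis G_bound : forall y, X y -> enorm (G y) <= B / 2.

Variables (dT : measure_display) (T : measurableType dT) (Pr : probability T R).
Variables (M Mh : nat -> set (set T)).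
Hypothesis M_half : forall k, <<s M k >> `<=` <<s Mh k >>.
Hypothesis Mh_next : forall k, <<s Mh k >> `<=` <<s M k.+1 >>.
Hypothesis Mh_sub : forall k, <<s Mh k >> `<=` measurable.

(* measurability of a random vector for the sigma-algebra generated by N *)
Local Notation adapted N f := (@coord_measurable R n _ (g_sigma_algebraType N) f).

Variables (x xh w wh : nat -> T -> 'cV[R]_n) (gamma : nat -> R) (nu : R).
Hypothesis gamma_gt0 : forall k, 0 < gamma k.
Hypothesis x_in : forall k t, X (x k t).
Hypothesis xh_step : forall k t, xh k t = proj X (x k t - gamma k *: (G (x k t) + w k t)).
Hypothesis x_step : forall k t,
  x k.+1 t = proj X (x k t - gamma k *: (G (xh k t) + wh k t)).
Hypothesis x_adapted : forall k, adapted (M k) (x k).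
Hypothesis xh_adapted : forall k, adapted (Mh k) (xh k).
Hypothesis w_sqr : forall k,
  cond_exp_as Pr <<s M k >> (fun t => enorm (w k t) ^+ 2) (fun y => y <= nu ^+ 2).
Hypothesis wh_sqr : forall k,
  cond_exp_as Pr <<s Mh k >> (fun t => enorm (wh k t) ^+ 2) (fun y => y <= nu ^+ 2).
Hypothesis wh_mean0 : forall k (i : 'I_n),
  cond_exp_as Pr <<s Mh k >> (fun t => wh k t i ord0) (fun y => y = 0).

Notation S := (SVI_sol X G).
Notation pi := (proj S).

(** The coefficient of [gamma k ^+ 2] in the expected error of one step. *)
Definition step_const : R := alpha ^+ 2 + 3 * B ^+ 2 + 6 * nu ^+ 2.

Lemma step_const_ge0 : 0 <= step_const.
Proof.
by rewrite /step_const !addr_ge0// ?sqr_ge0// mulr_ge0// sqr_ge0.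
Qed.

Lemma M_sub k : <<s M k >> `<=` measurable.
Proof. exact: subset_trans (@M_half k) (@Mh_sub k). Qed.

Lemma M_mono i j : (i <= j)%N -> <<s M i >> `<=` <<s M j >>.
Proof.
move=> /subnK <-; elim: (j - i)%N => //= k IH.
by rewrite addSn; apply: subset_trans IH _; apply: subset_trans (@M_half _) (@Mh_next _).
Qed.

Lemma adapted_sub (N1 N2 : set (set T)) (f : T -> 'cV[R]_n) :
  <<s N1 >> `<=` <<s N2 >> -> adapted N1 f -> adapted N2 f.
Proof.
move=> N12 mf i _ A mA; apply: N12; exact: (mf i measurableT A mA).
Qed.

Lemma adapted_measurable (N : set (set T)) (f : T -> 'cV[R]_n) :
  <<s N >> `<=` measurable -> adapted N f -> coord_measurable f.
Proof. move=> NT mf i _ A mA; apply: NT; exact: (mf i measurableT A mA). Qed.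

Lemma xh_near k t : enorm (xh k t - x k t) <= gamma k * (B / 2 + enorm (w k t)).
Proof.
rewrite xh_step -[X in _ - X](proj_id X_neq0 X_closed X_convex (x_in k t)).
apply: le_trans (proj_lip X_neq0 X_closed X_convex _ _) _.
rewrite addrAC subrr add0r enormN enormZ gtr0_norm// ler_pM2l//.
apply: le_trans (enormD _ _) _; rewrite lerD2r.
exact: G_bound.
Qed.

(** The second noise term is orthogonal to everything known after the first
    half step. *)
Lemma noise_orthogonal k (E : set T) (v : T -> 'cV[R]_n) (a : R) :
  <<s M k >> E -> adapted (M k) v ->
  (forall t, E t -> enorm (x k t - v t) ^+ 2 <= a) ->
  Pr.-integrable E (fun t => (dotv (wh k t) (xh k t - v t))%:E) /\
  \int[Pr]_(t in E) dotv (wh k t) (xh k t - v t) = 0.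
Proof.
move=> FE v_ad Ea.
have FhE : <<s Mh k >> E by exact: M_half.
have mE : measurable E by exact: (M_sub FE).
have mD : adapted (Mh k) (fun t => xh k t - v t).
  apply: coord_measurableB; first exact: xh_adapted.
  exact: adapted_sub (@M_half k) v_ad.
have [iw _] := cond_exp_le (@M_sub k) (w_sqr k).
have [iwh _] := cond_exp_le (@Mh_sub k) (wh_sqr k).
(* an integrable bound for each term of the inner product *)
pose dom t := enorm (wh k t) ^+ 2 + ((4 * gamma k ^+ 2) * enorm (w k t) ^+ 2 +
  (gamma k ^+ 2 * B ^+ 2 + 2 * a)).
have idom : Pr.-integrable E (EFin \o dom).
  rewrite /dom /comp; under eq_fun do rewrite EFinD.
  apply: integrableD => //; first exact: integrableS iwh.
  under eq_fun do rewrite EFinD.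
  apply: integrableD => //; last exact: finite_measure_integrable_cst.
  under eq_fun do rewrite EFinM.
  by apply: integrableZl => //; exact: integrableS iw.
have bound i t : E t -> `|wh k t i ord0 * (xh k t - v t) i ord0| <= dom t.
  move=> Et; rewrite normrM.
  have h1 := enorm_coord (wh k t) i; have h2 := enorm_coord (xh k t - v t) i.
  have h3 := enorm_triangle (xh k t) (x k t) (v t); have h4 := xh_near k t.
  have h5 := Ea _ Et; rewrite /dom.
  have h6 := normr_ge0 (wh k t i ord0); have h7 := normr_ge0 ((xh k t - v t) i ord0).
  exact: (product_dominated h6 h7 h1 h2 h3 (enorm_ge0 _) (enorm_ge0 _) h4 h5).
have mwh i : measurable_fun [set: T] (fun t => wh k t i ord0).
  have [iwhi _] := cond_exp_mean0 (@Mh_sub k) (wh_mean0 k i).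
  by apply/measurable_EFinP; exact: measurable_int iwhi.
have iprod i : Pr.-integrable E (fun t => (wh k t i ord0 * (xh k t - v t) i ord0)%:E).
  apply: le_integrable idom => //.
    apply/measurable_EFinP; apply: measurable_funM.
      exact: measurable_funS (mwh i).
    by apply: (measurable_funS measurableT) => //; exact: (adapted_measurable (@Mh_sub k) mD).
  move=> t Et; rewrite /= lee_fin; apply: le_trans (bound i t Et) _.
  exact: ler_norm.
have dE t : (dotv (wh k t) (xh k t - v t))%:E =
    (\sum_(i < n) (wh k t i ord0 * (xh k t - v t) i ord0)%:E)%E.
  by rewrite dotvE sumEFin.
split.
  by under eq_fun do rewrite dE; exact: integrable_sum.
rewrite /Rintegral; under eq_integral do rewrite dE.
rewrite (integral_sum mE (f := fun i t => (wh k t i ord0 * (xh k t - v t) i ord0)%:E))//.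
rewrite big1// => i _.
have [iwhi wh0] := cond_exp_mean0 (@Mh_sub k) (wh_mean0 k i).
by apply: (ortho (@Mh_sub k) iwhi wh0 FhE) => //; exact: (mD i).
Qed.


Lemma x_measurable k : coord_measurable (x k).
Proof. exact: (adapted_measurable (@M_sub k) (@x_adapted k)). Qed.

Lemma pi_continuous : continuous pi.
Proof.
apply: proj_continuous => //.
  exact: (@sol_closed _ _ _ X_closed X_convex _ _ G_mono L_ge0 G_lip).
exact: (@sol_convex _ _ _ X_convex _ _ G_mono L_ge0 G_lip).
Qed.

Lemma pi_in y : S (pi y).
Proof.
apply: proj_in => //.
  exact: (@sol_closed _ _ _ X_closed X_convex _ _ G_mono L_ge0 G_lip).
exact: (@sol_convex _ _ _ X_convex _ _ G_mono L_ge0 G_lip).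
Qed.

Lemma pi_adapted k : adapted (M k) (fun t => pi (x k t)).
Proof. exact: (coord_measurable_cont (@x_adapted k) pi_continuous). Qed.

(** The distance from the [k]-th iterate to the solution set. *)
Definition sol_dist k t : R := enorm (x k t - pi (x k t)).

Lemma sol_dist_ge0 k t : 0 <= sol_dist k t.
Proof. exact: enorm_ge0. Qed.

Lemma sol_dist_sub_measurable k : sub_measurable (M k) (sol_dist k).
Proof.
apply: measurable_enorm; apply: coord_measurableB; first exact: x_adapted.
exact: pi_adapted.
Qed.

Lemma sol_dist_measurable k : measurable_fun [set: T] (sol_dist k).
Proof. exact: (sub_measurableW (@M_sub k) (@sol_dist_sub_measurable k)). Qed.

Lemma sqr_dist_sub_measurable k (N : set (set T)) (v : T -> 'cV[R]_n) :
  <<s M k >> `<=` <<s N >> -> adapted N v ->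
  sub_measurable N (fun t => enorm (x k t - v t) ^+ 2).
Proof.
move=> MN v_ad; apply: measurable_funX; apply: measurable_enorm.
by apply: coord_measurableB => //; exact: adapted_sub MN (@x_adapted k).
Qed.

(** One step in expectation, on an event of the past on which the distance to
    the moving target [v] is bounded. *)
Lemma expected_step k (E : set T) (v : T -> 'cV[R]_n) (a : R) :
  <<s M k >> E -> adapted (M k) v -> (forall t, S (v t)) ->
  (forall t, E t -> enorm (x k t - v t) ^+ 2 <= a) ->
  [/\ Pr.-integrable E (fun t => (enorm (x k.+1 t - v t) ^+ 2)%:E),
      Pr.-integrable E (fun t => (sol_dist k t)%:E) &
  \int[Pr]_(t in E) (enorm (x k.+1 t - v t) ^+ 2) +
    2 * alpha * gamma k * \int[Pr]_(t in E) sol_dist k t <=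
  \int[Pr]_(t in E) (enorm (x k t - v t) ^+ 2) + gamma k ^+ 2 * step_const].
Proof.
move=> FE v_ad Sv Ea.
have mE : measurable E by exact: (M_sub FE).
have vm : coord_measurable v by exact: (adapted_measurable (@M_sub k) v_ad).
have [iw wle] := cond_exp_le (@M_sub k) (w_sqr k).
have [iwh whle] := cond_exp_le (@Mh_sub k) (wh_sqr k).
have [iN N0] := noise_orthogonal FE v_ad Ea.
have mU j : measurable_fun E (fun t => enorm (x j t - v t) ^+ 2).
  apply: (measurable_funS measurableT) => //; apply: measurable_funX.
  by apply: measurable_enorm; apply: coord_measurableB => //; exact: x_measurable.
have md : measurable_fun E (sol_dist k).
  by apply: (measurable_funS measurableT) => //; exact: sol_dist_measurable.
have iU : Pr.-integrable E (fun t => (enorm (x k t - v t) ^+ 2)%:E).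
  apply: (@le_integrable _ _ _ _ _ mE _ (fun t => (cst a t)%:E)).
  - exact/measurable_EFinP.
  - move=> t Et; rewrite /= lee_fin ger0_norm ?sqr_ge0//.
    by apply: le_trans (Ea t Et) _; exact: ler_norm.
  - exact: finite_measure_integrable_cst.
pose c0 := gamma k ^+ 2 * (alpha ^+ 2 + 3 * B ^+ 2).
pose c1 := 3 * gamma k ^+ 2.
pose rhs t := enorm (x k t - v t) ^+ 2 + (c0 + (c1 * enorm (w k t) ^+ 2 +
  (c1 * enorm (wh k t) ^+ 2 + (- (2 * gamma k)) * dotv (wh k t) (xh k t - v t)))).
have iwE : Pr.-integrable E (EFin \o (fun t => enorm (w k t) ^+ 2)).
  exact: integrableS iw.
have iwhE : Pr.-integrable E (EFin \o (fun t => enorm (wh k t) ^+ 2)).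
  exact: integrableS iwh.
have icst r : Pr.-integrable E (EFin \o (fun _ : T => r)).
  exact: finite_measure_integrable_cst.
have iZ r (f : T -> R) : Pr.-integrable E (EFin \o f) ->
    Pr.-integrable E (EFin \o (fun t => r * f t)).
  by move=> fi; rewrite /comp; under eq_fun do rewrite EFinM; exact: integrableZl.
have iD (f g : T -> R) : Pr.-integrable E (EFin \o f) -> Pr.-integrable E (EFin \o g) ->
    Pr.-integrable E (EFin \o (fun t => f t + g t)).
  by move=> fi gi; rewrite /comp; under eq_fun do rewrite EFinD; exact: integrableD.
have i4 := iZ (- (2 * gamma k)) _ iN.
have i3 := iD _ _ (iZ c1 _ iwhE) i4.
have i2 := iD _ _ (iZ c1 _ iwE) i3.
have i1 := iD _ _ (icst c0) i2.
have irhs : Pr.-integrable E (EFin \o rhs) := iD _ _ iU i1.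
have path t : enorm (x k.+1 t - v t) ^+ 2 + 2 * alpha * gamma k * sol_dist k t <= rhs t.
  have := extragradient_step X_neq0 X_closed X_convex G_mono L_ge0 G_lip alpha_gt0
    sol_neq0 sharp G_bound (w k t) (wh k t) (gamma_gt0 k) (x_in k t) (Sv t).
  rewrite /= -xh_step -x_step => /le_trans; apply.
  by rewrite /rhs /c0 /c1 le_eqVlt; apply/orP; left; apply/eqP; ring.
have ag0 : 0 < 2 * alpha * gamma k by rewrite mulr_gt0// mulr_gt0.
have iU1 : Pr.-integrable E (EFin \o (fun t => enorm (x k.+1 t - v t) ^+ 2)).
  apply: le_integrable irhs => //; first exact/measurable_EFinP.
  move=> t Et; rewrite /= lee_fin ger0_norm ?sqr_ge0//.
  apply: le_trans (ler_norm _); apply: le_trans (path t).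
  by rewrite lerDl mulr_ge0 ?(ltW ag0)// sol_dist_ge0.
have iad : Pr.-integrable E (EFin \o (fun t => 2 * alpha * gamma k * sol_dist k t)).
  apply: le_integrable irhs => //.
    by apply/measurable_EFinP; apply: measurable_funM => //; exact: measurable_cst.
  move=> t Et; rewrite /= lee_fin (ger0_norm (mulr_ge0 (ltW ag0) (sol_dist_ge0 k t))).
  apply: le_trans (ler_norm _); apply: le_trans (path t).
  by rewrite lerDr sqr_ge0.
have idist : Pr.-integrable E (EFin \o sol_dist k).
  have := iZ (2 * alpha * gamma k)^-1 _ iad; apply: eq_integrable => // t _ /=.
  by rewrite mulrA mulVf ?mul1r// gt_eqF.
split => //.
rewrite -RintegralZl// -RintegralD//.
apply: le_trans (le_Rintegral mE (iD _ _ iU1 iad) irhs (fun t _ => path t)) _ => /=.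
rewrite /rhs RintegralD// lerD2l RintegralD// RintegralD//; last exact: iZ.
rewrite RintegralD//; last exact: iZ.
rewrite !RintegralZl// N0 mulr0 addr0 Rintegral_cst//.
have P1 : fine (Pr E) <= 1.
  by rewrite -lee_fin fineK ?probability_le1// fin_num_measure.
have := wle _ FE; have := whle _ (M_half FE).
have P0 : 0 <= fine (Pr E) by rewrite fine_ge0.
have g2 := sqr_ge0 (gamma k); have n2 := sqr_ge0 nu.
have nP : nu ^+ 2 * fine (Pr E) <= nu ^+ 2 by rewrite ler_piMr.
have cP : c0 * fine (Pr E) <= c0.
  by rewrite ler_piMr// mulr_ge0// addr_ge0 ?sqr_ge0// mulr_ge0// sqr_ge0.
have c1_ge0 : 0 <= c1 by exact: mulr_ge0.
move=> h1 h2.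
have h3 : c1 * \int[Pr]_(t in E) (enorm (w k t) ^+ 2) <= c1 * nu ^+ 2.
  by rewrite ler_wpM2l//; exact: le_trans h2 nP.
have h4 : c1 * \int[Pr]_(t in E) (enorm (wh k t) ^+ 2) <= c1 * nu ^+ 2.
  by rewrite ler_wpM2l//; exact: le_trans h1 nP.
rewrite mulrA -/c0; apply: le_trans (lerD cP (lerD h3 h4)) _.
by rewrite /c0 /c1 /step_const le_eqVlt; apply/orP; left; apply/eqP; ring.
Qed.


(** The part of [E] on which the iterates of index [k + 1] to [k + N] have
    squared distance less than [c] to the target [v]. *)
Fixpoint survival k (v : T -> 'cV[R]_n) (c : R) (E : set T) (N : nat) : set T :=
  if N is N'.+1 then
    survival k v c E N' `&` [set t | enorm (x (k + N'.+1)%N t - v t) ^+ 2 < c]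
  else E.

Lemma survival_past k v c E N : <<s M k >> E -> adapted (M k) v ->
  <<s M (k + N)%N >> (survival k v c E N).
Proof.
move=> FE v_ad; elim: N => [|N IH] /=; first by rewrite addn0.
have vN : adapted (M (k + N.+1)%N) v by apply: adapted_sub v_ad; apply: M_mono; exact: leq_addr.
have := sqr_dist_sub_measurable (@subset_refl _ _) vN => mU.
have := mU measurableT `]-oo, c[%classic (measurable_itv _); rewrite setTI => mc.
have E1 : <<s M (k + N.+1)%N >> (survival k v c E N).
  by apply: (M_mono (i := (k + N)%N)); rewrite ?leq_add2l.
have := @measurableI _ (g_sigma_algebraType (M (k + N.+1)%N)) _ _ E1 mc.
by congr (measurable (_ `&` _)); apply/seteqP; split=> t /=; rewrite in_itv.
Qed.

Lemma survival_measurable k v c E N : <<s M k >> E -> adapted (M k) v ->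
  measurable (survival k v c E N).
Proof. by move=> FE v_ad; apply: M_sub; exact: survival_past. Qed.

Lemma survival_sub k v c E N : survival k v c E N `<=` E.
Proof. by elim: N => //= N IH t [/IH]. Qed.

Lemma survivalP k v c E N t : survival k v c E N t <->
  E t /\ forall j, (0 < j <= N)%N -> enorm (x (k + j)%N t - v t) ^+ 2 < c.
Proof.
elim: N => [|N IH] /=.
  by split=> [Et|[]//]; split=> //; case.
split=> [[/IH[Et H] HN]|[Et H]].
  split=> // j /andP[j0]; rewrite leq_eqVlt => /orP[/eqP->//|jN].
  by apply: H; rewrite j0.
split; last by apply: H; rewrite /= leqnn.
by apply/IH; split=> // j /andP[j0 jN]; apply: H; rewrite j0/= leqW.
Qed.

(** Maximal inequality: starting at time [k] within squared distance [a] of [v]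
    on the event [E], the iterates are unlikely to leave the ball of squared
    radius [c]; the accumulated distances to the solution set, as long as they
    have not left, are controlled as well. *)
Lemma maximal_inequality k (v : T -> 'cV[R]_n) (a c : R) E N :
  <<s M k >> E -> adapted (M k) v -> (forall t, S (v t)) ->
  (forall t, E t -> enorm (x k t - v t) ^+ 2 <= a) -> 0 <= a -> a <= c ->
  c * prob Pr (E `\` survival k v c E N) +
  \sum_(j < N) 2 * alpha * gamma (k + j)%N *
     \int[Pr]_(t in survival k v c E j) sol_dist (k + j) t <=
  a + step_const * \sum_(j < N) gamma (k + j)%N ^+ 2.
Proof.
move=> FE v_ad Sv Ea a0 ac.
have mE : measurable E by exact: (M_sub FE).
pose U j t := enorm (x (k + j)%N t - v t) ^+ 2.
have ms j := survival_measurable c j FE v_ad.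
have vj j : adapted (M (k + j)%N) v.
  by apply: adapted_sub v_ad; apply: M_mono; exact: leq_addr.
have sc j t : survival k v c E j t -> U j t <= c.
  case: j => [/Ea|j [_ /ltW//]]; rewrite /U addn0 => /le_trans; exact.
have step j := expected_step (@survival_past k v c E j FE v_ad) (vj j) Sv (sc j).
suff : c * prob Pr (E `\` survival k v c E N) +
    \int[Pr]_(t in survival k v c E N) U N t +
    \sum_(j < N) 2 * alpha * gamma (k + j)%N *
     \int[Pr]_(t in survival k v c E j) sol_dist (k + j) t <=
    a + step_const * \sum_(j < N) gamma (k + j)%N ^+ 2.
  apply: le_trans; rewrite lerD2r lerDl; apply: Rintegral_ge0 => t _; exact: sqr_ge0.
have iU j : Pr.-integrable (survival k v c E j) (EFin \o U j).
  apply: (@le_integrable _ _ _ _ _ (ms j) _ (EFin \o cst c)).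
  - apply/measurable_EFinP; apply: (measurable_funS measurableT) => //.
    exact: (sub_measurableW (@M_sub _) (sqr_dist_sub_measurable (@subset_refl _ _) (vj j))).
  - move=> t /sc Uc; rewrite /= lee_fin ger0_norm ?sqr_ge0//.
    by apply: le_trans Uc _; exact: ler_norm.
  - exact: finite_measure_integrable_cst.
elim: N => [|N IH].
  rewrite !big_ord0 /= setDv addr0 mulr0 addr0 /prob measure0 mulr0 add0r.
  apply: (@le_trans _ _ (a * prob Pr E)).
    apply: (Rintegral_le_prob mE (iU 0%N)).
    by move=> t /Ea; rewrite /U addn0.
  by rewrite ler_piMr// prob_le1.
rewrite !big_ord_recr.
have [iU1 idst st] := step N.
have sN1 : survival k v c E N.+1 = survival k v c E N `&` [set t | U N.+1 t < c] by [].
set D := survival k v c E N in IH iU1 idst st sN1 *.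
set D1 := survival k v c E N.+1 in sN1 *.
have mD : measurable D := ms N.
have mD1 : measurable D1 := ms N.+1.
have D1D : D1 `<=` D by rewrite sN1; exact: subIsetl.
rewrite -addnS in iU1 st.
have mDD1 : measurable (D `\` D1) by exact: measurableD.
have split_int : \int[Pr]_(t in D) U N.+1 t =
    \int[Pr]_(t in D1) U N.+1 t + \int[Pr]_(t in D `\` D1) U N.+1 t.
  rewrite -Rintegral_setU ?setDUK//.
  by apply/disj_setPS => t [h1 []].
have leave : c * prob Pr (D `\` D1) <= \int[Pr]_(t in D `\` D1) U N.+1 t.
  apply: Rintegral_ge_prob => //.
    by apply: (integrableS mD) => //; exact: subDsetl.
  move=> t [Dt]; rewrite sN1 => /not_andP[//|/negP]; by rewrite -leNgt.
have split_prob : prob Pr (E `\` D1) = prob Pr (E `\` D) + prob Pr (D `\` D1).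
  rewrite (probDI Pr (B := D) (measurableD mE mD1) mD); congr (_ + _); congr prob.
    apply/seteqP; split=> t /=; first by move=> [[Et _] nD].
    by move=> [Et nD]; split=> //; split=> // /D1D.
  apply/seteqP; split=> t /=; first by move=> [[Et nD1] Dt].
  by move=> [Dt nD1]; split=> //; split=> //; exact: survival_sub Dt.
rewrite split_prob mulrDr.
change (\int[Pr]_(t in D) (enorm (x (k + N.+1)%N t - v t) ^+ 2)) with
  (\int[Pr]_(t in D) U N.+1 t) in st.
change (\int[Pr]_(t in D) (enorm (x (k + N)%N t - v t) ^+ 2)) with
  (\int[Pr]_(t in D) U N t) in st.
rewrite split_int in st.
set s1 := \sum_(j < N) 2 * alpha * _ * _ in IH *.
set s2 := \sum_(j < N) gamma _ ^+ 2 in IH *.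
apply: (telescoping_arith IH _ leave).
by move: st => /=.
Qed.


Hypothesis gamma_sqr : (\sum_(0 <= k <oo) (gamma k ^+ 2)%:E < +oo)%E.
Hypothesis gamma_sum : (\sum_(0 <= k <oo) (gamma k)%:E = +oo)%E.

Let gamma_ge0 k : 0 <= gamma k. Proof. exact: ltW. Qed.
Let gamma_sqr_ge0 k : 0 <= gamma k ^+ 2. Proof. exact: sqr_ge0. Qed.

(** Up to an event of small probability, the expected distances to the solution
    set are summable against the step lengths. *)
Lemma expected_dist_summable (eta : R) : 0 < eta -> exists (D : nat -> set T) (K : R),
  [/\ forall j, measurable (D j),
      forall j, Pr.-integrable (D j) (EFin \o sol_dist j),
      forall N, prob Pr (~` D N) <= eta &
      forall N, \sum_(j < N) 2 * alpha * gamma j * \int[Pr]_(t in D j) sol_dist j t <= K].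
Proof.
move=> eta0; pose u0 := pi 0.
have eta20 : 0 < eta / 2 by rewrite divr_gt0.
have u0_ad j : adapted (M j) (fun=> u0) by move=> i; exact: measurable_cst.
have U0 : sub_measurable (M 0) (fun t => enorm (x 0 t - u0) ^+ 2).
  exact: (sqr_dist_sub_measurable (@subset_refl _ _) (u0_ad 0%N)).
pose A (m : nat) : set T := [set t | enorm (x 0 t - u0) ^+ 2 < m%:R].
have FA m : <<s M 0 >> (A m).
  have := U0 measurableT `]-oo, m%:R[%classic (measurable_itv _); rewrite setTI.
  by congr (<<s M 0 >> _); apply/seteqP; split=> t /=; rewrite in_itv.
(* the distance from the initial point to u0 may have no moments: it is bounded
   on an event of large probability *)
have [m Hm] : exists m, prob Pr (~` A m) <= eta / 2.
  apply: prob_cover => //.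
  - by move=> m; exact: (M_sub (FA m)).
  - move=> i j ij; apply/subsetPset => t /= /lt_le_trans; apply.
    by rewrite ler_nat.
  - apply/seteqP; split=> // t _.
    exists (Num.bound (enorm (x 0 t - u0) ^+ 2)) => //=.
    by apply: le_lt_trans (archi_boundP _); rewrite ?sqr_ge0.
have [Q HQ] := summable_bounded gamma_sqr_ge0 gamma_sqr.
have Q0 : 0 <= Q by have := HQ 0%N; rewrite big_ord0.
pose K : R := m%:R + step_const * Q.
have K0 : 0 <= K by rewrite addr_ge0// mulr_ge0// step_const_ge0.
(* with this squared radius the bound K / c on the probability of leaving the
   ball is below eta / 2 *)
pose c := m%:R + K / (eta / 2) + 1.
have cm : m%:R <= c by rewrite /c -addrA lerDl addr_ge0// divr_ge0// ltW.
have Ea t : A m t -> enorm (x 0 t - u0) ^+ 2 <= m%:R by exact: ltW.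
have Su0 : S u0 by exact: pi_in.
have max N := maximal_inequality N (FA m) (u0_ad 0%N) (fun=> Su0) Ea (ler0n _ _) cm.
have rhs N : m%:R + step_const * \sum_(j < N) gamma (0 + j)%N ^+ 2 <= K.
  by rewrite lerD2l ler_wpM2l ?step_const_ge0//; exact: HQ.
have mD N : measurable (survival 0 (fun=> u0) c (A m) N).
  exact: (@survival_measurable 0%N (fun=> u0) c _ N (FA m) (u0_ad 0%N)).
have step N := @expected_step N (survival 0 (fun=> u0) c (A m) N) (fun=> u0) c.
exists (survival 0 (fun=> u0) c (A m)), K; split => //.
- move=> j; have [] // := step j.
    exact: (@survival_past 0%N (fun=> u0) c _ j (FA m) (u0_ad 0%N)).
  move=> t; case: j => [/Ea/le_trans|j [_ /ltW//]]; exact.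
- move=> N; have mA : measurable (A m) := M_sub (FA m).
  have : prob Pr (A m `\` survival 0 (fun=> u0) c (A m) N) <= eta / 2.
    have p0 := prob_ge0 Pr (A m `\` survival 0 (fun=> u0) c (A m) N).
    have : c * prob Pr (A m `\` survival 0 (fun=> u0) c (A m) N) <= K.
      apply: le_trans (rhs N); apply: le_trans (max N); rewrite lerDl.
      apply: sumr_ge0 => j _; rewrite mulr_ge0 ?mulr_ge0 ?(ltW alpha_gt0)//.
      by apply: Rintegral_ge0 => t _; exact: sol_dist_ge0.
    move=> cpK; rewrite leNgt; apply/negP => peta.
    have c0 : 0 < c by rewrite /c ltr_wpDl// addr_ge0// divr_ge0// ltW.
    have := lt_le_trans (_ : c * (eta / 2) < _) cpK; rewrite ltr_pM2l// => /(_ peta).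
    have -> : c * (eta / 2) = m%:R * (eta / 2) + K + eta / 2.
      by rewrite /c 2!mulrDl divfK ?gt_eqF// mul1r.
    have : 0 <= m%:R * (eta / 2) by rewrite mulr_ge0// ltW.
    move: (m%:R * (eta / 2)) (K) (eta) eta0 => *; lra.
  move=> Hs; apply: le_trans (_ : prob Pr (~` A m `|` (A m `\` survival 0 (fun=> u0) c (A m) N)) <= _).
    apply: prob_le; [exact: measurableC| |].
      by apply: measurableU; [exact: measurableC|exact: measurableD].
    by move=> t nst; have [At|] := pselect (A m t); [right|left].
  apply: le_trans (probU_le _ _ _) _; [exact: measurableC|exact: measurableD|].
  by move: Hm Hs; lra.
- move=> N; apply: le_trans (rhs N); apply: le_trans (max N).
  rewrite lerDr mulr_ge0 ?prob_ge0//.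
  by rewrite /c addr_ge0// addr_ge0// divr_ge0// ltW.
Qed.

(** The iterates come close to the solution set, at arbitrarily late times. *)
Lemma dist_small (eps eta : R) (K : nat) : 0 < eps -> 0 < eta ->
  exists2 k, (K <= k)%N & prob Pr [set t | eps < sol_dist k t] <= eta.
Proof.
move=> eps0 eta0; apply: contrapT => H.
have far k : (K <= k)%N -> eta < prob Pr [set t | eps < sol_dist k t].
  by move=> Kk; rewrite ltNge; apply/negP => Hk; apply: H; exists k.
have eta20 : 0 < eta / 2 by rewrite divr_gt0.
have [D [Q [mD iD PD HQ]]] := expected_dist_summable eta20.
have mfar k : measurable [set t | eps < sol_dist k t].
  have := @sol_dist_measurable k measurableT `]eps, +oo[%classic (measurable_itv _).
  by rewrite setTI; congr measurable; apply/seteqP; split=> t /=; rewrite in_itv/= andbT.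
(* from time K on, the expected distances would be bounded below, so that their
   weighted sums would diverge with the sums of the step lengths *)
have low k : (K <= k)%N -> eps * (eta / 2) <= \int[Pr]_(t in D k) sol_dist k t.
  move=> Kk; have mI : measurable (D k `&` [set t | eps < sol_dist k t]) by exact: measurableI.
  have pI : eta / 2 <= prob Pr (D k `&` [set t | eps < sol_dist k t]).
    have h1 := far _ Kk; have h2 := PD k.
    have h3 : prob Pr [set t | eps < sol_dist k t] <=
        prob Pr (D k `&` [set t | eps < sol_dist k t]) + prob Pr (~` D k).
      apply: le_trans (probU_le _ mI (measurableC (mD k))).
      apply: prob_le => //; first by apply: measurableU => //; exact: measurableC.
      by move=> t /= Ht; have [Dt|] := pselect (D k t); [left|right].
    move: h1 h2 h3; lra.
  apply: le_trans (_ : eps * prob Pr (D k `&` [set t | eps < sol_dist k t]) <= _).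
    by rewrite ler_pM2l.
  have iI : Pr.-integrable (D k `&` [set t | eps < sol_dist k t]) (EFin \o sol_dist k).
    by apply: integrableS (iD k) => //; exact: subIsetl.
  have iJ : Pr.-integrable (D k `\` [set t | eps < sol_dist k t]) (EFin \o sol_dist k).
    by apply: integrableS (iD k) => //; exact: measurableD.
  apply: le_trans (Rintegral_ge_prob mI iI _) _; first by move=> t [_ /ltW].
  have DE : D k = (D k `&` [set t | eps < sol_dist k t]) `|`
      (D k `\` [set t | eps < sol_dist k t]) by rewrite setUIDK.
  rewrite [X in _ <= \int[Pr]_(t in X) _]DE Rintegral_setU//.
  - by rewrite lerDl; apply: Rintegral_ge0 => t _; exact: sol_dist_ge0.
  - exact: measurableD.
  - by rewrite -DE.
  - by apply/disj_setPS => t [[_ h] [_ /(_ h)]].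
pose b := 2 * alpha * (eps * (eta / 2)).
have b0 : 0 < b by rewrite mulr_gt0 ?mulr_gt0.
have [N HN] := divergent_large gamma_ge0 (\sum_(j < K) gamma j + Q / b) gamma_sum.
have : \sum_(j < N) gamma j <= \sum_(j < K + N) gamma j.
  by apply: partial_sum_mono => //; exact: leq_addl.
rewrite big_split_ord/= => HN'.
have : b * \sum_(j < N) gamma (K + j)%N <= Q.
  apply: le_trans (HQ (K + N)%N); rewrite big_split_ord/= mulr_sumr.
  apply: ler_wpDl.
    apply: sumr_ge0 => j _; rewrite mulr_ge0 ?mulr_ge0 ?(ltW alpha_gt0)//.
    by apply: Rintegral_ge0 => t _; exact: sol_dist_ge0.
  apply: ler_sum => j _.
  have -> : b * gamma (K + j)%N = 2 * alpha * gamma (K + j)%N * (eps * (eta / 2)).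
    by rewrite /b; ring.
  by rewrite ler_wpM2l ?low ?leq_addr// mulr_ge0// mulr_ge0// ltW.
rewrite -ler_pdivlMl// mulrC => HQ'.
by have := lt_le_trans HN HN'; rewrite ltrD2l ltNge HQ'.
Qed.


(** The event that, at some time from [k] to [k + N], the iterate is at squared
    distance at least [c] from the projection of the [k]-th iterate on the
    solution set. *)
Definition strays (k : nat) (c : R) (N : nat) : set T :=
  [set t | exists2 j, (j <= N)%N & c <= enorm (x (k + j)%N t - pi (x k t)) ^+ 2].

Lemma pi_measurable k : coord_measurable (fun t => pi (x k t)).
Proof. exact: (coord_measurable_cont (@x_measurable k) pi_continuous). Qed.

Lemma strays_measurable k c N : measurable (strays k c N).
Proof.
rewrite (_ : strays k c N = \bigcup_j
    (if (j <= N)%N then [set t | c <= enorm (x (k + j)%N t - pi (x k t)) ^+ 2] else set0)).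
  apply: bigcupT_measurable => j; case: ifP => // _.
  have : measurable_fun [set: T] (fun t => enorm (x (k + j)%N t - pi (x k t)) ^+ 2).
    apply: measurable_funX; apply: measurable_enorm; apply: coord_measurableB.
      exact: x_measurable.
    exact: pi_measurable.
  move=> /(_ measurableT `[c, +oo[%classic (measurable_itv _)); rewrite setTI.
  by congr measurable; apply/seteqP; split=> t /=; rewrite in_itv/= andbT.
apply/seteqP; split=> t /=.
  by move=> [j jN cj]; exists j => //; rewrite jN.
by move=> [j _]; case: ifP => // jN cj; exists j.
Qed.

(** At some time, all later iterates stay close to the current projection on
    the solution set, except on an event of small probability. *)
Lemma strays_small (c eta : R) : 0 < c -> 0 < eta ->
  exists k, forall N, prob Pr (strays k c N) <= eta.
Proof.
move=> c0 eta0; have C0 := step_const_ge0.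
(* with eps ^+ 2 <= q, the bound c / 2 keeps the starting point strictly inside
   the ball, and the bound c * (eta / 4) is its share in the maximal inequality *)
pose q := Num.min (c / 2) (c * (eta / 4)).
have q0 : 0 < q by rewrite lt_min !divr_gt0//= mulr_gt0// divr_gt0.
pose eps := Num.min 1 q.
have eps0 : 0 < eps by rewrite lt_min ltr01 q0.
have epsq : eps ^+ 2 <= q.
  apply: (@le_trans _ _ eps); last by rewrite ge_min lexx orbT.
  by rewrite expr2 ler_piMr ?(ltW eps0)// ge_min lexx.
have epsc : eps ^+ 2 < c.
  apply: le_lt_trans epsq _; apply: (@le_lt_trans _ _ (c / 2)); first by rewrite ge_min lexx.
  by rewrite ltr_pdivrMr// mulr_natr mulr2n ltrDl.
have epse : eps ^+ 2 <= c * (eta / 4).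
  by apply: le_trans epsq _; rewrite ge_min lexx orbT.
have tail0 : 0 < c * (eta / 4) / (step_const + 1).
  by rewrite divr_gt0 ?mulr_gt0 ?divr_gt0// ltr_wpDl.
have [K HK] := summable_tail gamma_sqr_ge0 gamma_sqr tail0.
have eta20 : 0 < eta / 2 by rewrite divr_gt0.
have [k Kk Hk] := dist_small K eps0 eta20.
exists k => N.
pose E := [set t | sol_dist k t <= eps].
have FE : <<s M k >> E.
  have := @sol_dist_sub_measurable k measurableT `]-oo, eps]%classic (measurable_itv _).
  by rewrite setTI; congr (<<s M k >> _); apply/seteqP; split=> t /=; rewrite in_itv.
have mE : measurable E := M_sub FE.
have Ea t : E t -> enorm (x k t - pi (x k t)) ^+ 2 <= eps ^+ 2.
  by move=> Et; rewrite ler_pXn2r ?nnegrE ?enorm_ge0// ltW.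
have := maximal_inequality N FE (@pi_adapted k) (fun t => pi_in (x k t)) Ea
  (sqr_ge0 eps) (ltW epsc).
set D := survival _ _ _ _ N.
have mD : measurable D.
  exact: (@survival_measurable k (fun t => pi (x k t)) c E N FE (@pi_adapted k)).
move=> max.
have pD : prob Pr (E `\` D) <= eta / 2.
  rewrite -(ler_pM2l c0).
  have h1 : c * prob Pr (E `\` D) <=
      eps ^+ 2 + step_const * \sum_(j < N) gamma (k + j)%N ^+ 2.
    apply: le_trans max; rewrite lerDl; apply: sumr_ge0 => j _.
    rewrite mulr_ge0 ?mulr_ge0 ?(ltW alpha_gt0)//.
    by apply: Rintegral_ge0 => t _; exact: sol_dist_ge0.
  have h2 : step_const * \sum_(j < N) gamma (k + j)%N ^+ 2 <= c * (eta / 4).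
    apply: le_trans (ler_wpM2l C0 (HK k N Kk)) _.
    rewrite mulrCA ger_pMr; last by rewrite mulr_gt0// divr_gt0.
    by rewrite ler_pdivrMr ?mul1r ?lerDl// ltr_wpDl.
  apply: le_trans h1 _; apply: le_trans (lerD epse h2) _.
  by rewrite -mulrDr le_eqVlt; apply/orP; left; apply/eqP; congr (_ * _); field.
have mS := strays_measurable k c N.
apply: le_trans (_ : prob Pr (~` E `|` (E `\` D)) <= _).
  apply: prob_le => //; first by apply: measurableU; [exact: measurableC|exact: measurableD].
  move=> t [j jN cj]; have [Et|] := pselect (E t); [right|by left].
  split=> // /survivalP[_ Hj].
  have [j0|j0] := posnP j; last by have := Hj j; rewrite j0 jN ltNge cj => /(_ isT).
  by move: cj; rewrite j0 addn0 leNgt (le_lt_trans (Ea _ Et)).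
apply: le_trans (probU_le _ _ _) _; [exact: measurableC|exact: measurableD|].
have h : prob Pr (~` E) <= eta / 2.
  apply: le_trans Hk; rewrite le_eqVlt; apply/orP; left; apply/eqP; congr prob.
  by apply/seteqP; split=> t /=; rewrite /E/= ltNge => /negP.
by move: h pD; lra.
Qed.

Lemma ae_stays_close (c : R) : 0 < c ->
  {ae Pr, forall t, exists k, forall j, enorm (x (k + j)%N t - pi (x k t)) ^+ 2 < c}.
Proof.
move=> c0; pose Bad k := \bigcup_N strays k c N.
have mBad k : measurable (Bad k).
  by apply: bigcupT_measurable => N; exact: strays_measurable.
have mZ : measurable (\bigcap_k Bad k) by exact: bigcapT_measurable.
exists (\bigcap_k Bad k); split => //.
  rewrite probE//; congr EFin; apply/eqP; rewrite eq_le prob_ge0 andbT.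
  apply/ler_addgt0Pr => eta eta0; rewrite add0r.
  have [k Hk] := strays_small c0 eta0.
  apply: le_trans (_ : prob Pr (Bad k) <= _).
    by apply: prob_le => // t; exact.
  apply: prob_bigcup_le => // [N|i j ij]; first exact: strays_measurable.
  by apply/subsetPset => t [m mi cm]; exists m => //; exact: leq_trans mi ij.
move=> t /forallNP H k _; have /existsNP[j /negP] := H k.
by rewrite -leNgt => cj; exists j => //; exists j.
Qed.

(** The iterates form a Cauchy sequence and approach the closed solution set. *)
Theorem iterates_converge :
  {ae Pr, forall t, exists xs, S xs /\ (fun k => x k t) @ \oo --> xs}.
Proof.
have : {ae Pr, forall t (m : nat), exists k, forall j,
    enorm (x (k + j)%N t - pi (x k t)) ^+ 2 < m.+1%:R^-1 ^+ 2}.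
  by apply/ae_foralln => m; apply: ae_stays_close; rewrite exprn_gt0// invr_gt0.
apply: filterS => t Ht.
have close (e : R) : 0 < e -> exists k, forall j, (k <= j)%N -> enorm (x j t - pi (x k t)) < e.
  move=> e0; have [m _ /(_ m (leqnn m))/= me] := near_infty_natSinv_lt (PosNum e0).
  have [k Hk] := Ht m; exists k => j /subnKC <-; apply: lt_trans me.
  by have := Hk (j - k)%N; rewrite ltr_pXn2r// ?nnegrE ?enorm_ge0// invr_ge0.
have [l xl] : exists l : 'cV[R]_n, (fun k => x k t) @ \oo --> l.
  apply: enorm_cauchy => e e0; have e20 : 0 < e / 2 by rewrite divr_gt0.
  have [k Hk] := close _ e20; exists k => i j ki kj.
  have := enorm_triangle (x i t) (pi (x k t)) (x j t).
  rewrite (enormB (pi _)); have := Hk _ ki; have := Hk _ kj.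
  by move: (enorm _) (enorm _) (enorm _) => a b d; lra.
exists l; split => //.
have Sclosed : closed S by exact: (@sol_closed _ _ _ X_closed X_convex _ _ G_mono L_ge0 G_lip).
apply: (enorm_closedP S).1 => // e e0; have e20 : 0 < e / 2 by rewrite divr_gt0.
have [k Hk] := close _ e20.
have [N HN] := (enorm_cvgP _ _).1 xl _ e20.
exists (pi (x k t)); first exact: pi_in.
have := enorm_triangle l (x (maxn k N) t) (pi (x k t)).
have := Hk _ (leq_maxl k N); have := HN _ (leq_maxr k N).
by move: (enorm _) (enorm _) (enorm _) => a b d; lra.
Qed.

End StochasticExtragradient.

(** * Histories of the sampled scheme *)

Section Histories.
Variables (R : realType) (n : nat) (dO : measure_display) (Omega : measurableType dO).
Variables (dT : measure_display) (T : measurableType dT).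
Variables (x0 : T -> 'cV[R]_n) (omega omegah : nat -> T -> Omega).
Hypothesis x0_meas : forall B, borel B -> measurable (x0 @^-1` B).
Hypothesis omega_meas : forall k, measurable_fun [set: T] (omega k).
Hypothesis omegah_meas : forall k, measurable_fun [set: T] (omegah k).

(** Generators of the histories before the first and before the second sample of
    step [k]. *)
Definition past (k : nat) : set (set T) :=
  preimage_set_system [set: T] x0 (@borel 'cV[R]_n) `|`
  \bigcup_(j in [set j | (j < k)%N])
    (preimage_set_system [set: T] (omega j) measurable `|`
     preimage_set_system [set: T] (omegah j) measurable).

Definition past_half (k : nat) : set (set T) :=
  <<s past k >> `|` preimage_set_system [set: T] (omega k) measurable.

Lemma past_sub_half k : <<s past k >> `<=` <<s past_half k >>.
Proof. by move=> A FA; apply: sub_sigma_algebra; left. Qed.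

Lemma past_half_sub_next k : <<s past_half k >> `<=` <<s past k.+1 >>.
Proof.
apply: smallest_sub; first exact: smallest_sigma_algebra.
move=> A [|oA]; last by apply: sub_sigma_algebra; right; exists k => //=; left.
apply: sub_sigma_algebra2 => B [|[j jk oB]]; first by left.
by right; exists j => //=; rewrite ltnW.
Qed.

Lemma past_half_measurable k : <<s past_half k >> `<=` measurable.
Proof.
have meas_pre (Y : T -> Omega) : measurable_fun [set: T] Y ->
    preimage_set_system [set: T] Y measurable `<=` measurable.
  by move=> mY _ [B mB <-]; exact: mY.
apply: smallest_sub; first exact: sigma_algebra_measurable.
move=> A [|]; last exact: meas_pre.
apply: smallest_sub A; first exact: sigma_algebra_measurable.
move=> A [[B bB <-]|[j _ []]]; [|exact: meas_pre|exact: meas_pre].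
by rewrite setTI; exact: x0_meas.
Qed.

Lemma past0_x0 : @coord_measurable R n _ (g_sigma_algebraType (past 0)) x0.
Proof.
apply: borel_coord_measurable => B bB; apply: sub_sigma_algebra; left.
by exists B => //; rewrite setTI.
Qed.

Lemma half_omega k :
  @measurable_fun _ _ (g_sigma_algebraType (past_half k)) Omega [set: T] (omega k).
Proof. by move=> _ B mB; apply: sub_sigma_algebra; right; exists B. Qed.

Lemma next_omegah k :
  @measurable_fun _ _ (g_sigma_algebraType (past k.+1)) Omega [set: T] (omegah k).
Proof.
by move=> _ B mB; apply: sub_sigma_algebra; right; exists k => //=; right; exists B.
Qed.

End Histories.

Theorem proposition3 (R : realType) (n d : nat)
  (X : set 'cV[R]_n) (X_neq0 : X !=set0) (X_closed : closed X)
  (X_convex : convex_set X)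
  (dO : measure_display) (Omega : measurableType dO) (P : probability Omega R)
  (xi : Omega -> 'cV[R]_d)
  (xi_meas : forall B : set 'cV[R]_d, borel B -> measurable (xi @^-1` B))
  (F : 'cV[R]_n -> 'cV[R]_d -> 'cV[R]_n)
  (F_meas : borel_measurable_on (X `*` [set: 'cV[R]_d])
              (fun p : 'cV[R]_n * 'cV[R]_d => F p.1 p.2))
  (F_int : forall x, X x -> forall i : 'I_n,
     P.-integrable [set: Omega] (fun o => (F x (xi o) i ord0)%:E))
  (F_cont : {within X, continuous (mean_map P xi F)})
  (F_mono : monotone_on X (mean_map P xi F))
  (sol_neq0 : SVI_sol X (mean_map P xi F) !=set0)
  (gamma : nat -> R) (gamma_gt0 : forall k, 0 < gamma k)
  (gamma_to0 : gamma @ \oo --> (0 : R))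
  (dT : measure_display) (T : measurableType dT) (Pr : probability T R)
  (omega omegah : nat -> T -> Omega)
  (omega_meas : forall k, measurable_fun [set: T] (omega k))
  (omegah_meas : forall k, measurable_fun [set: T] (omegah k))
  (x xh : nat -> T -> 'cV[R]_n)
  (x0_meas : forall B : set 'cV[R]_n, borel B -> measurable (x 0%N @^-1` B))
  (x0_X : forall t, X (x 0%N t))
  (ESA : is_ESA X P xi F gamma omega omegah x xh)
  (A1 : forall k (i : 'I_n),
     cond_exp_as Pr (history (x 0%N) omega omegah k)
       (fun t => noise P xi F (x k t) (omega k t) i ord0) (fun y => y = 0) /\
     cond_exp_as Pr (history_half (x 0%N) omega omegah k)
       (fun t => noise P xi F (xh k t) (omegah k t) i ord0) (fun y => y = 0))
  (A2 : exists nu : R, 0 < nu /\ forall k,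
     cond_exp_as Pr (history (x 0%N) omega omegah k)
       (fun t => enorm (noise P xi F (x k t) (omega k t)) ^+ 2)
       (fun y => y <= nu ^+ 2) /\
     cond_exp_as Pr (history_half (x 0%N) omega omegah k)
       (fun t => enorm (noise P xi F (xh k t) (omegah k t)) ^+ 2)
       (fun y => y <= nu ^+ 2))
  (A3 : (\sum_(0 <= k <oo) (gamma k ^+ 2)%:E < +oo)%E)
  (A4 : (\sum_(0 <= k <oo) (gamma k)%:E = +oo)%E)
  (A5 : exists L B : R, 0 < L /\ 0 < B /\ forall y z, X y -> X z ->
     enorm (mean_map P xi F y - mean_map P xi F z) <= L * enorm (y - z) /\
     enorm (mean_map P xi F y) <= B / 2)
  (alpha : R) (alpha_gt0 : 0 < alpha)
  (sharp : weak_sharp X (mean_map P xi F) alpha) :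
  {ae Pr, forall t, exists xs, SVI_sol X (mean_map P xi F) xs /\
     (fun k => x k t) @ \oo --> xs}.
Proof.
have [nu [nu0 A2']] := A2; have [L [B [L0 [B0 A5']]]] := A5.
pose M := past (x 0%N) omega omegah.
pose Mh := past_half (x 0%N) omega omegah.
have x_in k t : X (x k t).
  by case: k => [//|k]; rewrite (ESA k t).2; exact: proj_in.
have xh_in k t : X (xh k t) by rewrite (ESA k t).1; exact: proj_in.
have xi_coord : coord_measurable xi by exact: borel_coord_measurable.
(* each update is a measurable function of the iterates and of one sample *)
have update d1 (T1 : measurableType d1) (f g : T1 -> 'cV[R]_n) (o : T1 -> Omega) c :
    coord_measurable f -> coord_measurable g -> (forall t, X (g t)) ->
    measurable_fun [set: T1] o -> coord_measurable (fun t =>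
      proj X (f t - c *: (mean_map P xi F (g t) + noise P xi F (g t) (o t)))).
  move=> mf mg Xg mo; apply: (coord_measurable_cont (phi := proj X)); last first.
    exact: proj_continuous.
  apply: coord_measurableB => //; apply: coord_measurableZ.
  have := coord_measurable_borel_on F_meas Xg mg (coord_measurable_comp mo xi_coord).
  congr coord_measurable; apply: funext => t.
  by rewrite /noise addrC subrK.
have xh_ad k : @coord_measurable R n _ (g_sigma_algebraType (M k)) (x k) ->
    @coord_measurable R n _ (g_sigma_algebraType (Mh k)) (xh k).
  move=> xk; have xk' := adapted_sub (@past_sub_half _ _ _ _ _ _ _ _ _ k) xk.
  have := update _ _ _ _ _ (gamma k) xk' xk' (x_in k) (@half_omega _ _ _ _ _ _ _ _ _ k).
  congr coord_measurable; apply: funext => t; exact/esym/(ESA k t).1.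
have x_ad k : @coord_measurable R n _ (g_sigma_algebraType (M k)) (x k).
  elim: k => [|k xk]; first exact: past0_x0.
  have sub := subset_trans (@past_sub_half _ _ _ _ _ _ (x 0%N) omega omegah k)
    (@past_half_sub_next _ _ _ _ _ _ _ _ _ k).
  have xk' := adapted_sub sub xk.
  have xhk' := adapted_sub (@past_half_sub_next _ _ _ _ _ _ _ _ _ k) (xh_ad k xk).
  have := update _ _ _ _ _ (gamma k) xk' xhk' (xh_in k) (@next_omegah _ _ _ _ _ _ _ _ _ k).
  congr coord_measurable; apply: funext => t; exact/esym/(ESA k t).2.
apply: (@iterates_converge R n X X_neq0 X_closed X_convex (mean_map P xi F) L alpha B
  F_mono (ltW L0) (fun y z Xy Xz => (A5' y z Xy Xz).1) alpha_gt0 sol_neq0 sharp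
  (fun y Xy => (A5' y y Xy Xy).2) dT T Pr M Mh (@past_sub_half _ _ _ _ _ _ _ _ _)
  (@past_half_sub_next _ _ _ _ _ _ _ _ _)
  (past_half_measurable x0_meas omega_meas omegah_meas) x xh
  (fun k t => noise P xi F (x k t) (omega k t))
  (fun k t => noise P xi F (xh k t) (omegah k t)) gamma nu gamma_gt0 x_in) => //.
- by move=> k t; exact: (ESA k t).1.
- by move=> k t; exact: (ESA k t).2.
- by move=> k; exact: xh_ad.
- by move=> k; exact: (A2' k).1.
- by move=> k; exact: (A2' k).2.
- by move=> k i; exact: (A1 k i).2.
Qed.
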